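(* Let $d\ge 2$ and $r\in\mathbb{N}\setminus\{1,2,4\}$. Any shift-invariant Markov random field $\mu$ adapted to $X_r$ is a Gibbs state for some shift-invariant nearest neighbor interaction. In particular, any shift-invariant Markov random field $\mu$ with $\mathrm{supp}(\mu)=X_r$ is a Gibbs state for some shift-invariant nearest neighbor interaction.
   Context: $\mathbb{Z}^d$ is regarded as the vertex set of the graph in which $n,m$ are adjacent iff $\|n-m\|_1=1$. For $F\subset\mathbb{Z}^d$, $\partial F$ is the set of sites outside $F$ adjacent to some site of $F$. For a finite set $\mathcal{A}$, $\mathcal{A}^{\mathbb{Z}^d}$ has the product topology; for finite $F$ and $a\in\mathcal{A}^F$, $[a]_F=\{x\in\mathcal{A}^{\mathbb{Z}^d}: x|_F=a\}$, and $[x]_F:=[x|_F]_F$. The shift action is $(\sigma_n x)_m=x_{m+n}$; a Borel probability measure $\mu$ is shift-invariant if $\mu\circ\sigma_n=\mu$ for all $n$. The space $X_r$: $Ht=\{\hat x\in\mathbb{Z}^{\mathbb{Z}^d}: |\hat x_n-\hat x_m|=1 \text{ whenever } \|n-m\|_1=1\}$ is the set of height functions; $\phi_r:Ht\to(\mathbb{Z}_r)^{\mathbb{Z}^d}$, $\mathbb{Z}_r=\mathbb{Z}/r\mathbb{Z}$, is coordinatewise reduction modulo $r$; and $X_r=\phi_r(Ht)$. A Markov random field is a Borel probability measure $\mu$ on $\mathcal{A}^{\mathbb{Z}^d}$ such that for all finite $A,B$ with $\partial A\subset B\subset A^c$ and all $a\in\mathcal{A}^A$, $b\in\mathcal{A}^B$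 with $\mu([b]_B)>0$, $\mu([a]_A\mid[b]_B)=\mu([a]_A\mid[b|_{\partial A}]_{\partial A})$. $\mathrm{supp}(\mu)$ is the smallest closed set of full measure. For $X\subset\mathcal A^{\mathbb Z^d}$, $\Delta_X$ is the set of pairs $(x,y)\in X\times X$ with $x_n=y_n$ for all but finitely many $n$. $\mu$ is adapted to $X$ if $\mathrm{supp}(\mu)\subset X$ and whenever $x\in\mathrm{supp}(\mu)$, $(x,y)\in\Delta_X$, then $y\in\mathrm{supp}(\mu)$. $\mathcal{B}(X)$ is the set of all patterns $x|_W$ with $x\in X$, $W\subset\mathbb{Z}^d$ finite. A nearest neighbor interaction on $X$ is a function $\phi:\mathcal{B}(X)\to\mathbb{R}$ with $\phi(a)=0$ whenever the set on which $a$ is defined has diameter greater than $1$ in the graph distance; it is shift-invariant if it takes the same value on a pattern and all its translates. A Gibbs state for a nearest neighbor interaction $\phi$ is a Markov random field $\mu$ such that for all $x\in\mathrm{supp}(\mu)$ and finite $A,B$ with $\partial A\subset B\subset A^c$, $$\mu([x]_A\mid[x]_B)=\frac{\prod_{C\subset A\cup\partial A}e^{\phi(x|_C)}}{Z_{A,x|_{\partial A}}},$$ where $Z_{A,x|_{\partial A}}$ is a normalizing factor depending only on $A$ and $x|_{\partial A}$. *)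

(* Defs.v *)
From HB Require Import structures.
From mathcomp Require Import all_boot all_order all_algebra finmap.
From mathcomp Require Import all_classical all_reals all_analysis.
From mathcomp Require Import zify.

Set Implicit Arguments.
Unset Strict Implicit.
Unset Printing Implicit Defensive.

Import Order.TTheory GRing.Theory Num.Theory.

Local Open Scope classical_set_scope.
Local Open Scope ring_scope.

(* Finite alphabets.  MathComp-Analysis builds sigma-algebras over pointed
   types only; the point itself plays no role below. *)
#[short(type="finPointedType")]
HB.structure Definition FinPointed := {T of Finite T & isPointed T}.

HB.instance Definition _ (n : nat) := isPointed.Build 'I_n.+1 ord0.

Notation site d := 'rV[int]_d.

Section Lattice.
Variable d : nat.

Definition l1norm (n : site d) : nat := (\sum_(i < d) absz (n ord0 i))%N.

Definition adj : rel (site d) := fun n m => l1norm (n - m) == 1%N.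

Definition graph_dist_le (k : nat) (n m : site d) : Prop :=
  exists p : seq (site d), [/\ path adj n p, last n p = m & (size p <= k)%N].

Definition diam_le (k : nat) (W : {fset site d}) : Prop :=
  forall n m, n \in W -> m \in W -> graph_dist_le k n m.

Definition boundary_set (F : {fset site d}) : set (site d) :=
  [set m | m \notin F /\ exists2 n : site d, n \in F & adj n m].

(* [fset_set] is a junk value on infinite sets; [finite_boundary] and
   [mem_boundary] show that this does not occur here. *)
Definition boundary (F : {fset site d}) : {fset site d} :=
  fset_set (boundary_set F).

Lemma finite_boundary (F : {fset site d}) : finite_set (boundary_set F).
Proof.
pose g (n : site d) (f : {ffun 'I_d -> 'I_3}) : site d :=
  n - \row_i ((f i : nat)%:Z - 1).
apply: (@sub_finite_set _ _ (\bigcup_(n in [set` F]) range (g n))); last first.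
  apply: bigcup_finite; first exact: finite_fset.
  by move=> n _; apply: finite_image; exact: finite_finset.
move=> m [_ [n nF nm]]; exists n => //.
have le1 i : (absz ((n - m)%R ord0 i) <= 1)%N.
  apply: (@leq_trans (l1norm (n - m))); last by rewrite (eqP nm).
  by rewrite /l1norm (bigD1 i) //= leq_addr.
exists [ffun i => inord (absz ((n - m)%R ord0 i + 1)%R)] => //.
apply/rowP => i; rewrite !mxE ffunE.
have := le1 i; rewrite !mxE.
set x : int := n _ i; set y : int := m _ i => xy.
rewrite (inordK (_ : (absz (x - y + 1)%R < 3)%N)); last by lia.
by lia.
Qed.

Lemma mem_boundary (F : {fset site d}) (m : site d) :
  (m \in boundary F) <-> boundary_set F m.
Proof.
by rewrite in_fset_set; [split => [/set_mem|/mem_set] | exact: finite_boundary].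
Qed.

End Lattice.

Section Configurations.
Variables (d : nat) (A : finPointedType).

Definition config : Type := prod_topology (fun _ : site d => discrete_topology A).
HB.instance Definition _ := Pointed.on config.
HB.instance Definition _ := Topological.on config.

Definition borel_config := g_sigma_algebraType (@open config).

(* The keys [domf a] of a pattern [a] are the sites on which it is defined. *)
Definition pattern : Type := {fmap site d -> A}.

Definition restr (x : config) (W : {fset site d}) : pattern :=
  [fmap k : W => (x (val k) : A)].

Definition cylinder (a : pattern) : set config :=
  [set x | restr x (domf a) = a].

Definition shift (n : site d) (x : config) : config := fun m => x (m + n).

Definition patterns_of (X : set config) : set pattern :=
  [set a | exists x W, X x /\ a = restr x W].

Definition translates (a b : pattern) : Prop :=
  exists n : site d, forall m : site d, b.[? m]%fmap = a.[? (m + n)%R]%fmap.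

Definition homoclinic (X : set config) : set (config * config) :=
  [set xy | [/\ X xy.1, X xy.2 & finite_set [set n | xy.1 n <> xy.2 n]]].

Variable R : realType.

(* An interaction on X is a function on [patterns_of X]; it is represented by
   a total function whose values outside [patterns_of X] are unconstrained and
   irrelevant. *)
Definition nn_interaction (X : set config) (phi : pattern -> R) : Prop :=
  forall a, patterns_of X a -> ~ diam_le 1 (domf a) -> phi a = 0.

Definition shift_invariant_interaction (X : set config) (phi : pattern -> R) :
    Prop :=
  forall a b, patterns_of X a -> patterns_of X b -> translates a b ->
    phi a = phi b.

Implicit Type mu : probability borel_config R.

Definition shift_invariant mu : Prop :=
  forall (n : site d) (E : set borel_config),
    measurable E -> mu (shift n @` E) = mu E.

Definition cond_prob mu (E F : set config) : R :=
  fine (mu (E `&` F)) / fine (mu F).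

Definition markov_random_field mu : Prop :=
  forall a b : pattern,
    (boundary (domf a) `<=` domf b)%fset -> [disjoint domf a & domf b]%fset ->
    (0 < mu (cylinder b))%E ->
    cond_prob mu (cylinder a) (cylinder b) =
    cond_prob mu (cylinder a) (cylinder b.[& boundary (domf a)]%fmap).

Definition supp mu : set config :=
  smallest [set C : set config | closed C /\ mu C = 1%E] set0.

Definition adapted mu (X : set config) : Prop :=
  supp mu `<=` X /\
  forall x y, supp mu x -> homoclinic X (x, y) -> supp mu y.

Definition gibbs_state (phi : pattern -> R) mu : Prop :=
  markov_random_field mu /\
  exists Z : {fset site d} -> pattern -> R,
  forall (x : config) (F B : {fset site d}),
    supp mu x -> (boundary F `<=` B)%fset -> [disjoint F & B]%fset ->
    cond_prob mu (cylinder (restr x F)) (cylinder (restr x B)) =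
    (\prod_(C <- fpowerset (F `|` boundary F)%fset) expR (phi (restr x C)))
      / Z F (restr x (boundary F)).

End Configurations.

Definition height_functions (d : nat) : set (site d -> int) :=
  [set h | forall n m, l1norm (n - m) = 1%N -> `|h n - h m| = 1].
Arguments height_functions d : clear implicits.

(* ['Z_r] is the ring of integers modulo r only for r >= 2. *)
Definition mod_map (d r : nat) (h : site d -> int) : config d 'Z_r :=
  fun n => (h n)%:~R.

Definition X_ (d r : nat) : set (config d 'Z_r) :=
  @mod_map d r @` height_functions d.
Arguments X_ d r : clear implicits.

(* Main.v *)
Require Import Defs.
From HB Require Import structures.
From mathcomp Require Import all_boot all_order all_algebra finmap.
From mathcomp Require Import all_classical all_reals all_analysis.
From mathcomp Require Import zify ring lra.

(** Why the theorem holds.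

    A point of [X_ d r] lifts to a height function, uniquely up to an additive
    constant because 2 is not 0 modulo r, and for d at least 2 two homoclinic
    points have lifts that agree off a finite set ([homoclinic_lift]).  Two
    such lifts are joined by finitely many flips, each moving one site from
    k - 1 to k + 1 while all its neighbours stand at k ([flip_connected]).  By
    the Markov property and shift-invariance the logarithm of the ratio of
    probabilities before and after a flip depends only on k modulo r: it is
    [flip_rate mu k].

    The flip rates are the only data of the measure that matter.  An
    interaction giving the value v k to every edge with spins k and k + 1
    changes by [degree d] times v k - v (k - 1) under a flip at k, so it
    reproduces the flip rates exactly when they sum to zero over Z/r.  In
    general ([cyclic_decomposition], [cocycle_formula]) the log-ratio of two
    homoclinic points is gamma times the total height difference plus the
    difference of an edge energy; and gamma can be taken to be zero as soon as
    one of the flips never occurs, since its rate is then a free parameter.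

    It remains to exclude gamma <> 0 when all flips occur ([no_drift]).  Say
    gamma > 0; the other case is the same after changing the sign of heights.
    Raise the heights inside a large box as far as the outside values allow.
    Since the raised pattern has probability at most 1, a total gain of e costs
    the original pattern a factor exp (- gamma e + O(volume)); there are only
    exp (O(volume)) patterns, so the expected gain per site is bounded
    independently of the box.  After raising, no site is a local minimum, so
    from a site deep inside there is a path of any prescribed length along
    which the raised height falls at every step; hence the original height
    falls along one of the 2d axis directions with a number of upward steps
    bounded by the gain at the site ([steep_axis]).  By shift-invariance the
    origin therefore has, with probability as close to 1 as desired and with a
    bound K that does not depend on L, an axis segment of length L with fewer
    than K upward steps ([prob_steep]).  But the local minima have positive
    density, each is followed by an upward step on any axis line through it,
    and a stationary set of points cannot return fewer than K times within
    distance L with probability more than K / L ([rare_returns]).  Letting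
    first K and then L be large gives a contradiction. *)

Set Implicit Arguments.
Unset Strict Implicit.
Unset Printing Implicit Defensive.

Import Order.TTheory GRing.Theory Num.Theory.

Local Open Scope classical_set_scope.
Local Open Scope ring_scope.

(** * The lattice graph *)
Section LatticeGeometry.
Variable d : nat.
Implicit Types (n m : site d) (F W : {fset site d}) (h g : site d -> int).

Lemma l1normN n : l1norm (- n) = l1norm n.
Proof. by apply: eq_bigr => i _; rewrite mxE abszN. Qed.

Lemma l1norm_distC n m : l1norm (n - m) = l1norm (m - n).
Proof. by rewrite -l1normN opprB. Qed.

Lemma l1norm_triangle n m : (l1norm (n + m) <= l1norm n + l1norm m)%N.
Proof.
rewrite /l1norm -big_split /=; apply: leq_sum => i _; rewrite mxE.
by set x : int := n ord0 i; set y : int := m ord0 i; lia.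
Qed.

Lemma coord_le_l1norm n i : (absz (n ord0 i) <= l1norm n)%N.
Proof. by rewrite /l1norm (bigD1 i) //= leq_addr. Qed.

Lemma l1norm0 : l1norm (0 : site d) = 0%N.
Proof. by rewrite /l1norm big1 // => i _; rewrite mxE. Qed.

Lemma l1norm_eq0 n : (l1norm n == 0%N) = (n == 0).
Proof.
apply/eqP/eqP => [|->]; last exact: l1norm0.
move=> /eqP; rewrite sum_nat_eq0 => /forallP n0.
by apply/rowP => i; rewrite mxE; apply/eqP; rewrite -absz_eq0; exact: n0.
Qed.

Lemma adjC n m : adj n m = adj m n.
Proof. by rewrite /adj l1norm_distC. Qed.

Lemma adj_neq n m : adj n m -> n != m.
Proof. by apply: contraTneq => ->; rewrite /adj subrr l1norm0. Qed.

Lemma adjDr k n m : adj (n + k) (m + k) = adj n m.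
Proof. by rewrite /adj opprD addrACA subrr addr0. Qed.

Definition axis (i : 'I_d) : site d := delta_mx ord0 i.

Lemma axisE i j : axis i ord0 j = if j == i then 1 else 0.
Proof. by rewrite mxE eqxx eq_sym; case: eqP. Qed.

Lemma l1norm_axis i (t : int) : l1norm (t *: axis i) = absz t.
Proof.
rewrite /l1norm (bigD1 i) //= big1 => [|j /negPf ji].
  by rewrite mxE axisE eqxx mulr1 addn0.
by rewrite mxE axisE ji mulr0.
Qed.

Lemma l1norm_subaxis n i (t : int) :
  (l1norm (n - t *: axis i) + absz (n ord0 i))%N
    = (l1norm n + absz (n ord0 i - t))%N.
Proof.
rewrite /l1norm (bigD1 i) //= [in RHS](bigD1 i) //= 3!mxE axisE eqxx mulr1.
rewrite (eq_bigr (fun j => absz (n ord0 j))).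
  by set x : int := n ord0 i; set S := (\sum_(j < d | _) _)%N; lia.
by move=> j /negPf ji; rewrite 3!mxE axisE ji mulr0 subr0.
Qed.

Lemma adj_axis n i (s : int) : absz s = 1%N -> adj n (n + s *: axis i).
Proof. by move=> s1; rewrite /adj opprD addNKr l1normN l1norm_axis s1. Qed.

Lemma step_to_origin n k : l1norm n = k.+1 -> exists2 m, adj n m & l1norm m = k.
Proof.
move=> nk.
have [i ni] : exists i, n ord0 i != 0.
  apply/existsP; apply: contra_eqT nk => /existsPn n0.
  by rewrite /l1norm big1 // => i _; have := n0 i; rewrite negbK => /eqP->.
pose s : int := if (n ord0 i < 0)%R then -1 else 1.
have s1 : absz s = 1%N by rewrite /s; case: ifP.
exists (n - s *: axis i); first by rewrite -scaleNr; apply: adj_axis; rewrite abszN.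
have := l1norm_subaxis n i s; rewrite nk; move: ni; rewrite /s.
by set x : int := n ord0 i; case: ltP => ? ?; lia.
Qed.

(** Connectedness of the lattice in the form of an induction principle, proved
    by induction on the l1-distance to [a]. *)
Lemma lattice_connected (Q : site d -> Prop) a :
  (forall n m, adj n m -> Q n -> Q m) -> Q a -> forall n, Q n.
Proof.
move=> QQ Qa n; have [k] := ubnP (l1norm (n - a)).
elim: k n => // k IH n; rewrite ltnS leq_eqVlt => /orP[/eqP nk|]; last exact: IH.
case: k IH nk => [_ /eqP|k IH nk].
  by rewrite l1norm_eq0 subr_eq0 => /eqP ->.
have [m nm mk] := step_to_origin nk.
apply: (QQ (m + a)); last by apply: IH; rewrite addrK mk.
by rewrite adjC -(adjDr (- a)) addrK.
Qed.

(** * Height functions and flips *)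
Lemma height_adj h n m : height_functions d h -> adj n m ->
  h m = h n + 1 \/ h m = h n - 1.
Proof. by move=> + /eqP nm => /(_ n m nm); lia. Qed.

Lemma heightP h :
  (forall n m, adj n m -> absz (h n - h m) = 1%N) -> height_functions d h.
Proof. by move=> H n m /eqP /H; lia. Qed.

Lemma height_lip h n m : height_functions d h ->
  (absz (h n - h m)%R <= l1norm (n - m)%R)%N.
Proof.
move=> hh; have [k] := ubnP (l1norm (n - m)).
elim: k n => // k IH n; rewrite ltnS leq_eqVlt => /orP[/eqP nk|]; last exact: IH.
case: k IH nk => [_ /eqP|k IH nk].
  by rewrite l1norm_eq0 subr_eq0 => /eqP ->; rewrite subrr.
have [a na ak] := step_to_origin nk.
have := IH (a + m); rewrite addrK ak => /(_ (ltnSn _)).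
have /(height_adj hh) : adj n (a + m) by rewrite -(adjDr (- m)) addrK.
lia.
Qed.

(** Adjacent heights have opposite parities, so the parity of the difference
    of two height functions is constant on the lattice.  This is why flips by
    2 suffice to connect them. *)
Lemma height_parity h g a n : height_functions d h -> height_functions d g ->
  h a = g a -> exists k : int, h n = g n + 2 * k.
Proof.
move=> hh hg ha; apply: (@lattice_connected
  (fun n => exists k : int, h n = g n + 2 * k) a) => [p q pq [k hk]|]; last first.
  by exists 0; rewrite mulr0 addr0.
have [H1|H1] := height_adj hh pq; have [H2|H2] := height_adj hg pq.
- by exists k; lia.
- by exists (k + 1); lia.
- by exists (k - 1); lia.
- by exists k; lia.
Qed.

Definition upd h n (v : int) : site d -> int := fun m => if m == n then v else h m.

Lemma height_upd h n (k : int) v : height_functions d h ->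
  (forall m, adj n m -> h m = k) -> absz (v - k) = 1%N ->
  height_functions d (upd h n v).
Proof.
move=> hh hk vk; apply: heightP => a b ab; rewrite /upd.
case: (eqVneq a n) => [an|an]; case: (eqVneq b n) => [bn|bn].
- by move: (adj_neq ab); rewrite an bn eqxx.
- by rewrite (hk b) // -an.
- by rewrite (hk a) ?(adjC n) -?bn //; lia.
- by have := height_adj hh ab; lia.
Qed.

Lemma seq_argmax (T : eqType) (s : seq T) (P : pred T) (f : T -> int) x :
  x \in s -> P x ->
  exists y, [/\ y \in s, P y & forall z, z \in s -> P z -> f z <= f y].
Proof.
elim: s x => // a s IH x; rewrite inE.
have [[b bs Pb]|no] := pselect (exists2 b, b \in s & P b); last first.
  case/orP => [/eqP -> Pa|xs Px]; last by case: no; exists x.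
  exists a; split; rewrite ?mem_head // => z; rewrite inE => /orP[/eqP ->//|zs Pz].
  by case: no; exists z.
have [y [ys Py ymax]] := IH b bs Pb => _ _.
have [/andP[Pa ya]|na] := boolP (P a && (f y <= f a)).
  exists a; split; rewrite ?mem_head // => z; rewrite inE => /orP[/eqP ->//|zs Pz].
  exact: le_trans (ymax z zs Pz) ya.
exists y; split => //; first by rewrite inE ys orbT.
move=> z; rewrite inE => /orP[/eqP -> Pa|]; last exact: ymax.
by move: na; rewrite Pa /= -ltNge => /ltW.
Qed.

(** Among the sites where [h] exceeds [g], one where [h] is maximal is a local
    maximum of [h]: a higher neighbour [a] would satisfy [h a <= g a], and then
    [g] would be too large at the site itself.  There [h] can be lowered by 2
    without passing below [g]. *)
Lemma exists_flip h g F n : height_functions d h -> height_functions d g ->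
  (forall m, m \notin F -> h m = g m) -> n \in F -> g n < h n ->
  (exists a, a \notin F) ->
  exists2 m, m \in F & g m <= h m - 2 /\ forall a, adj m a -> h a = h m - 1.
Proof.
move=> hh hg hgF nF gh [b bF].
have [m [mF Pm mmax]] := @seq_argmax _ F (fun n => g n < h n) h n nF gh.
exists m => //; split.
  by have [k] := @height_parity h g b m hh hg (hgF _ bF); lia.
move=> a ma; have [up|//] := height_adj hh ma.
have ga := height_adj hg ma.
have [aF|aF] := boolP (a \in F); last by have := hgF _ aF; lia.
by have := mmax a aF; lia.
Qed.

(** Induction on the l1-distance of [h] and [g] over [F]: [exists_flip] lowers
    whichever of the two exceeds the other somewhere.  Only upward flips have
    to be checked, as [T] is symmetric. *)
Lemma flip_connected (T : (site d -> int) -> (site d -> int) -> Prop) F h g :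
  (forall h, height_functions d h -> T h h) ->
  (forall h g, T h g -> T g h) -> (forall h1 h2 h3, T h1 h2 -> T h2 h3 -> T h1 h3) ->
  (forall h n (k : int), n \in F -> height_functions d h ->
     height_functions d (upd h n (k + 1)) ->
     (forall m, adj n m -> h m = k) -> h n = k - 1 -> T h (upd h n (k + 1))) ->
  (exists a, a \notin F) ->
  height_functions d h -> height_functions d g ->
  (forall m, m \notin F -> h m = g m) -> T h g.
Proof.
move=> Trefl Tsym Ttrans Tflip Fco.
have [k] := ubnP (\sum_(n <- F) absz (h n - g n))%N.
have down f n : n \in F -> height_functions d f ->
    (forall a, adj n a -> f a = f n - 1) ->
    height_functions d (upd f n (f n - 2)) /\ T f (upd f n (f n - 2)).
  move=> nF hf nb; have hu : height_functions d (upd f n (f n - 2)).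
    by apply: height_upd nb _ => //; lia.
  split=> //; apply: Tsym.
  have {3}-> : f = upd (upd f n (f n - 2)) n (f n - 1 + 1).
    by apply/funext => a; rewrite /upd; case: eqVneq => // ->; rewrite subrK.
  apply: Tflip => //.
  - apply: (@height_upd _ _ (f n - 1)) => // [m nm|]; last by lia.
    by rewrite /upd eq_sym (negPf (adj_neq nm)) nb.
  - by move=> m nm; rewrite /upd eq_sym (negPf (adj_neq nm)) nb.
  - by rewrite /upd eqxx; lia.
elim: k h g => // k IH h g; rewrite ltnS => hk hh hg hgF.
have [[n [nF nhg]]|same] := pselect (exists n, n \in F /\ h n != g n); last first.
  suff -> : h = g by exact: Trefl.
  apply/funext => n; have [nF|] := boolP (n \in F); last exact: hgF.
  by apply/eqP; apply: contra_notT same => ?; exists n.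
have decr f f' m : m \in F -> f' m <= f m - 2 ->
   (\sum_(n <- F) absz (upd f m (f m - 2)%R n - f' n)%R < \sum_(n <- F) absz (f n - f' n)%R)%N.
  move=> mF le; rewrite !(bigD1_seq m) ?fset_uniq //= {1}/upd eqxx.
  rewrite (eq_bigr (fun n => absz (f n - f' n))); first by rewrite ltn_add2r; lia.
  by move=> i /negPf im; rewrite /upd im.
have [gh|hg'|] := ltgtP (g n) (h n); last by move=> e; rewrite e eqxx in nhg.
  have [m mF [le nb]] := exists_flip hh hg hgF nF gh Fco.
  have [hu Tu] := down _ _ mF hh nb.
  apply: (Ttrans _ _ _ Tu); apply: IH => //.
    exact: leq_trans (decr _ _ _ mF le) hk.
  by move=> a aF; rewrite /upd; case: eqVneq aF => [->|_ /hgF//]; rewrite mF.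
have hgF' m : m \notin F -> g m = h m by move=> /hgF.
have [m mF [le nb]] := exists_flip hg hh hgF' nF hg' Fco.
have [hu Tu] := down _ _ mF hg nb.
apply: Ttrans (Tsym _ _ Tu); apply: Tsym; apply: IH => //.
  apply: leq_trans (decr _ _ _ mF le) _; apply: leq_trans _ hk.
  by apply: leq_sum => i _; lia.
by move=> a aF; rewrite /upd; case: eqVneq aF => [->|_ /hgF'//]; rewrite mF.
Qed.

End LatticeGeometry.

(** * Boxes, maximal extensions and steep axes *)
Section Boxes.
Variable d : nat.

Definition box (a : int) (l : nat) : {fset site d} :=
  [fset (\row_i (a + (f i : nat)%:Z) : site d)%R | f : {ffun 'I_d -> 'I_l} in predT]%fset.

Lemma in_box a l (n : site d) :
  n \in box a l <-> forall i, (a <= n ord0 i) && (n ord0 i < a + l%:Z).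
Proof.
split=> [/imfsetP[f /= _ ->] i|H].
  by rewrite mxE; case: (f i) => j /= jl; lia.
have lt i : (absz (n ord0 i - a) < l)%N.
  by have := H i; set x : int := n ord0 i; lia.
apply/imfsetP; exists [ffun i => Ordinal (lt i)] => //=.
apply/rowP => i; rewrite !mxE ffunE /=.
by have := H i; set x : int := n ord0 i; lia.
Qed.

Lemma card_box a l : #|` box a l| = (l ^ d)%N.
Proof.
rewrite card_imfset /=; last first.
  move=> f g /rowP fg; apply/ffunP => i; apply: val_inj.
  by have := fg i; rewrite !mxE => /addrI[].
by rewrite -cardE card_ffun !card_ord.
Qed.

Definition centered_box (N : nat) : {fset site d} := box (- N%:Z) (N + N).+1.

Lemma in_centered_box N (n : site d) :
  n \in centered_box N <-> forall i, (absz (n ord0 i) <= N)%N.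
Proof.
split=> [/in_box nN i|nN]; first by have := nN i; set x : int := n ord0 i; lia.
by apply/in_box => i; have := nN i; set x : int := n ord0 i; lia.
Qed.

Lemma in_some_box (W : {fset site d}) : exists N, {subset W <= centered_box N}.
Proof.
exists (\max_(n <- W) l1norm n)%N => n nW; apply/in_centered_box => i.
by apply: leq_trans (coord_le_l1norm n i) _; rewrite (big_rem n nW) /= leq_maxl.
Qed.

End Boxes.

Section HeightExtension.
Variable d : nat.
Implicit Types (n m : site d) (F W : {fset site d}) (h g : site d -> int).

(** Raise local minima in [F] by 2 until none is left.  This terminates: the
    Lipschitz property bounds the height at each site by the value at a fixed
    site outside [F] plus the distance to it. *)
Lemma maximal_extension F h : height_functions d h -> (exists a, a \notin F) ->
  exists g, [/\ height_functions d g, forall m, m \notin F -> g m = h m,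
    forall m, h m <= g m &
    forall n, n \in F -> exists2 m, adj n m & g m = g n - 1].
Proof.
move=> hh [b bF].
have [k] := ubnP (\sum_(n <- F) absz (h b + l1norm (n - b) - h n)%R)%N.
elim: k h hh => // k IH h hh; rewrite ltnS => hk.
have [[n [nF nmin]]|no] := pselect (exists n, n \in F /\ forall m, adj n m -> h m = h n + 1).
  have hu : height_functions d (upd h n (h n + 2)).
    by apply: height_upd nmin _ => //; lia.
  have ub : upd h n (h n + 2) b = h b.
    by rewrite /upd; case: eqVneq => // e; rewrite e nF in bF.
  case: (IH _ hu) => [|g [hg gF gh gmin]].
    rewrite ub; apply: leq_trans hk.
    rewrite !(bigD1_seq n) ?fset_uniq //= {1}/upd eqxx.
    rewrite (eq_bigr (fun i => absz (h b + l1norm (i - b) - h i)%R)); last first.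
      by move=> i /negPf ni; rewrite /upd ni.
    by rewrite ltn_add2r; have := height_lip n b hu; rewrite ub /upd eqxx; lia.
  exists g; split=> // m.
    by move=> mF; rewrite gF // /upd; case: eqVneq mF => // ->; rewrite nF.
  by apply: le_trans (gh m); rewrite /upd; case: eqVneq => // ->; lia.
exists h; split=> // n nF; apply: contrapT => nolow; apply: no.
exists n; split=> // m nm; case: (height_adj hh nm) => // hm.
by case: nolow; exists m.
Qed.

(** Step repeatedly to a lower neighbour.  The path ends at distance exactly
    [k] because the height has dropped by [k] and is Lipschitz. *)
Lemma descending_path F g : height_functions d g ->
  (forall n, n \in F -> exists2 m, adj n m & g m = g n - 1) ->
  forall k n, (forall m, (l1norm (n - m) < k)%N -> m \in F) ->
  exists2 b, l1norm (n - b) = k & g b = g n - k%:Z.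
Proof.
move=> hg low; elim=> [|k IH] n nF.
  by exists n; rewrite ?subrr ?l1norm0 ?subr0.
have /low[m nm gm] : n \in F by apply: nF; rewrite subrr l1norm0.
have m1 : l1norm (n - m) = 1%N by apply/eqP.
have [a ma|b mb gb] := IH m.
  apply: nF; rewrite -(subrK m n) -addrA; apply: leq_ltn_trans (l1norm_triangle _ _) _.
  by rewrite m1.
exists b; last by rewrite gb gm; lia.
have := height_lip n b hg; have := l1norm_triangle (n - m) (m - b).
by rewrite addrA subrK m1 mb gb gm; move: (l1norm _) (g n) => p q; lia.
Qed.

(** The pair [(i, b)] is the direction of the i-th axis, negative if [b]. *)
Definition dir : Type := 'I_d * bool.
Definition dirv (e : dir) : site d := (if e.2 then -1 else 1) *: axis e.1.

Lemma adj_dirv n e : adj n (n + dirv e).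
Proof. by apply: adj_axis; case: e.2. Qed.

Definition upsteps h n (e : dir) (L : nat) : nat :=
  \sum_(j < L) (h (n + dirv e *+ j.+1) == h (n + dirv e *+ j) + 1)%R.

Lemma upstepsE h n e L : height_functions d h ->
  h (n + dirv e *+ L) = h n - L%:Z + 2 * (upsteps h n e L)%:Z.
Proof.
move=> hh; elim: L => [|L IH].
  by rewrite /upsteps big_ord0 mulr0n addr0; lia.
rewrite /upsteps big_ord_recr /= -/(upsteps h n e L).
have := height_adj hh (adj_dirv (n + dirv e *+ L) e).
rewrite -addrA -mulrSr; move: IH.
set x := h _; set y := h (n + _ *+ L.+1); set u := upsteps _ _ _ _.
by move=> IH [->|->]; case: eqP; lia.
Qed.

Lemma dirv_mulrn e L : dirv e *+ L = ((if e.2 then -1 else 1) * L%:Z) *: axis e.1.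
Proof. by rewrite -scaler_nat /dirv scalerA mulrC natz. Qed.

Lemma long_coordinate n L : (0 < d)%N -> l1norm n = (d * L)%N ->
  exists i, (L <= absz (n ord0 i))%N.
Proof.
move=> d0 nL; apply/existsP; apply: contra_eqT nL => /existsPn small.
case: L small => [|L] small; first by have := small (Ordinal d0).
rewrite ltn_eqF // mulnS -[X in (_ < X + _)%N]prednK //.
apply: (@leq_ltn_trans (\sum_(i < d) L)%N); last by rewrite sum_nat_const card_ord; lia.
by apply: leq_sum => i _; have := small i; rewrite -ltnNge ltnS.
Qed.

(** Follow a descending path of [g] of length [d * L] to [b].  Some coordinate
    of [b - n] is at least [L]; the end of the axis segment of length [L] in
    that direction lies on an l1-geodesic from [n] to [b], so the Lipschitz
    property of [h] and [h b <= g b] force [h] to drop along the segment by at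
    least [L - (g n - h n)].  Each upward step spoils the drop by 2. *)
Lemma steep_axis F h g n L : (0 < d)%N ->
  height_functions d h -> height_functions d g -> (forall m, h m <= g m) ->
  (forall n, n \in F -> exists2 m, adj n m & g m = g n - 1) ->
  (forall m, (l1norm (n - m) < d * L)%N -> m \in F) ->
  exists e, 2 * (upsteps h n e L)%:Z <= g n - h n.
Proof.
move=> d0 hh hg hle low deep.
have [b nb gb] := descending_path hg low deep.
have [i iL] : exists i, (L <= absz ((b - n)%R ord0 i))%N.
  by apply: long_coordinate => //; rewrite l1norm_distC.
pose e : dir := (i, (b - n) ord0 i < 0); exists e.
have := upstepsE n e L hh; have := height_lip (n + dirv e *+ L) b hh.
have -> : n + dirv e *+ L - b = - ((b - n) - dirv e *+ L) by rewrite !opprB addrA [_ + n]addrC.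
rewrite l1normN dirv_mulrn.
have := l1norm_subaxis (b - n) i ((if e.2 then -1 else 1) * L%:Z).
rewrite (l1norm_distC b) nb; have := hle b; rewrite gb; move: iL; rewrite /e /=.
move: (h _) => p; move: (l1norm _) => q.
by set x : int := (b - n) ord0 i; case: (ltP x 0) => ? ?; lia.
Qed.

End HeightExtension.

(** * Lifts of homoclinic configurations *)
Section Exterior.
Variables (d : nat) (N : nat).
Implicit Types (n m : site d).

Definition outer n := exists i, (N < absz (n ord0 i))%N.

(** Connectedness of the complement of a box, which needs [1 < d]: a coordinate
    can be moved freely while another one stays large, so all coordinates can
    be brought to [N + 1] one after the other. *)
Lemma exterior_constant (T : Type) (D : site d -> T) : (1 < d)%N ->
  (forall n m, adj n m -> outer n -> outer m -> D n = D m) ->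
  forall n, outer n -> D n = D (const_mx N.+1%:Z).
Proof.
move=> d1 Dadj.
have shift1 n i j (t : nat) : i != j -> (N < absz (n ord0 i))%N ->
    D (n + t%:Z *: axis j) = D n.
  move=> ij ni; have out s : outer (n + s *: axis j).
    by exists i; rewrite 2!mxE axisE (negPf ij) mulr0 addr0.
  elim: t => [|t IH]; first by rewrite scale0r addr0.
  rewrite -IH; apply/esym/Dadj => //.
  have -> : t.+1%:Z = t%:Z + 1 by lia.
  by rewrite scalerDl addrA; apply: adj_axis.
have setc n i j (v : int) : i != j -> (N < absz (n ord0 i))%N ->
    D (n + (v - n ord0 j) *: axis j) = D n.
  move=> ij ni; case: (ltP (n ord0 j) v) => [lt|le].
    have -> : v - n ord0 j = (absz (v - n ord0 j))%:Z by lia.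
    exact: shift1 ij ni.
  have ni' : (N < absz ((n + (v - n ord0 j) *: axis j)%R ord0 i))%N.
    by rewrite 2!mxE axisE (negPf ij) mulr0 addr0.
  have := @shift1 _ i j (absz (v - n ord0 j)) ij ni'.
  have -> : (absz (v - n ord0 j))%:Z = - (v - n ord0 j) by lia.
  by rewrite -addrA -scalerDl subrr scale0r addr0 => <-.
have setM n j i : (n + (N.+1%:Z - n ord0 j) *: axis j) ord0 i =
    if i == j then N.+1%:Z else n ord0 i.
  rewrite 2!mxE axisE; case: eqVneq => [->|_]; last by rewrite mulr0 addr0.
  by rewrite mulr1 addrC subrK.
move=> n; have [k] := ubnP #|[pred i | n ord0 i != N.+1%:Z]|.
elim: k n => // k IH n; rewrite ltnS => nk [i ni].
have [j nj|allM] := pickP [pred j | n ord0 j != N.+1%:Z]; last first.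
  by congr D; apply/rowP => j; rewrite mxE; apply/eqP; have := allM j => /negbFE.
(* Setting coordinate j' to N + 1 keeps coordinate i' large and decreases the
   number of coordinates different from N + 1. *)
have go i' j' : i' != j' -> (N < absz (n ord0 i'))%N -> n ord0 j' != N.+1%:Z ->
    D n = D (const_mx N.+1%:Z).
  move=> ij ni' nj'; rewrite -(setc n i' j' N.+1%:Z) //; apply: IH.
    apply: leq_trans nk; apply: proper_card; apply/properP; split.
      by apply/fintype.subsetP => l; rewrite !inE setM; case: (l == j'); rewrite ?eqxx.
    by exists j'; rewrite !inE ?setM ?eqxx.
  by exists i'; rewrite setM (negPf ij).
have [ij|ij] := eqVneq i j; last exact: (go i j).
have [l li] : exists l : 'I_d, l != i.
  case: (eqVneq (val i) 0%N) => i0.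
    by exists (Ordinal d1); rewrite -val_eqE /= i0.
  by exists (Ordinal (ltnW d1)); rewrite -val_eqE /= eq_sym.
have [nl|nl] := eqVneq (n ord0 l) N.+1%:Z.
  by apply: (go l j) => //; [rewrite -ij|rewrite nl].
by apply: (go i l) => //; rewrite eq_sym.
Qed.

End Exterior.

Section Lifts.
Variables (d r : nat).
Hypothesis d1 : (1 < d)%N.
Hypothesis two_neq0 : (1 + 1 : 'Z_r) != 0.
Implicit Types (n m : site d) (F : {fset site d}) (h g : site d -> int).

Lemma mod_map_step h n m : height_functions d h -> adj n m ->
  (mod_map r h m == mod_map r h n + 1) = (h m == h n + 1).
Proof.
move=> hh nm; case: (height_adj hh nm) => e; rewrite /mod_map e ?rmorphD ?rmorphB /=.
  by rewrite !eqxx.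
rewrite (inj_eq (addrI _)) (inj_eq (addrI _)) eq_sym -subr_eq0 opprK.
by rewrite (negPf two_neq0).
Qed.

Lemma mod_map_incr h g n m : height_functions d h -> height_functions d g ->
  adj n m -> mod_map r h n = mod_map r g n -> mod_map r h m = mod_map r g m ->
  h m - h n = g m - g n.
Proof.
move=> hh hg nm en em; have := mod_map_step hh nm; rewrite en em mod_map_step //.
by case: (height_adj hh nm) => ->; case: (height_adj hg nm) => ->;
  do 2 case: eqP; lia.
Qed.

(** The difference of the two lifts is locally constant where the reductions
    agree, hence equal to a constant [t] off a box.  As [t] reduces to 0,
    subtracting it from [g] gives another lift. *)
Lemma homoclinic_lift h g F : height_functions d h -> height_functions d g ->
  (forall m, m \notin F -> mod_map r h m = mod_map r g m) ->
  exists2 B : {fset site d}, (exists a, a \notin B) & exists g', [/\ height_functions d g',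
    mod_map r g' = mod_map r g & forall m, m \notin B -> h m = g' m].
Proof.
move=> hh hg hgF.
have [N FN] := in_some_box F.
have outF n : outer N n -> n \notin F.
  by move=> [i]; apply: contraTN => /FN /in_centered_box; rewrite -leqNgt; exact.
have cst := @exterior_constant d N _ (fun n => g n - h n) d1 _.
have {}cst n : outer N n -> g n - h n = g (const_mx N.+1%:Z) - h (const_mx N.+1%:Z).
  apply: cst => a b ab /outF aF /outF bF.
  have := mod_map_incr hh hg ab (hgF a aF) (hgF b bF); lia.
set t := _ - _ in cst.
have outc : outer N (const_mx N.+1%:Z : site d).
  by exists (Ordinal (ltnW d1)); rewrite mxE.
have t0 : t%:~R = 0 :> 'Z_r.
  rewrite /t rmorphB; apply/eqP; rewrite subr_eq0; apply/eqP/esym.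
  exact: (hgF _ (outF _ outc)).
have outB n : n \notin centered_box d N -> outer N n.
  move=> nB; apply: contrapT => no; case/negP: nB; apply/in_centered_box => i.
  by rewrite leqNgt; apply/negP => ?; apply: no; exists i.
exists (centered_box d N).
  exists (const_mx N.+1%:Z); apply/negP => /in_centered_box /(_ (Ordinal (ltnW d1))).
  by rewrite mxE /= ltnn.
exists (fun n => g n - t); split.
- by move=> n m /hg; lia.
- by apply/funext => n; rewrite /mod_map rmorphB /= t0 subr0.
- by move=> m /outB /cst; lia.
Qed.

End Lifts.

(** * Cylinders, local events and the support *)
Section LocalEvents.
Variables (d : nat) (A : finPointedType).
Implicit Types (x y : config d A) (W V F : {fset site d}) (E : set (config d A)).

Definition agree W x : set (config d A) := [set y | forall n, n \in W -> y n = x n].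

Definition local W E := forall x y, (forall n, n \in W -> x n = y n) -> E x -> E y.

(** The point of the alphabet is the default value off [W]. *)
Definition ext W (f : {ffun W -> A}) : config d A :=
  fun n => odflt point (omap f (insub n)).

Lemma ext_val W (f : {ffun W -> A}) (k : W) : ext f (val k) = f k.
Proof. by rewrite /ext valK. Qed.

Lemma restrE x y W : (restr x W = restr y W) <-> agree W y x.
Proof.
split=> [/fmapP e n nW|e].
  by have := e n; rewrite !in_fnd //= => -[]; rewrite !ffunE.
apply/fmapP => n; have [nW|nW] := boolP (n \in W); last by rewrite !not_fnd.
by rewrite !in_fnd !ffunE /= e.
Qed.

Lemma cylinder_restr x W : cylinder (restr x W) = agree W x.
Proof. by apply/seteqP; split => y /restrE. Qed.

Lemma open_agree W x : open (agree W x).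
Proof.
have -> : agree W x =
    \bigcap_(n in [set` W]) (proj n @^-1` [set a | a = x n] : set (config d A)).
  by apply/seteqP; split=> y H n; exact: H.
rewrite openE => y Hy; apply: filter_bigI => n nW; apply: open_nbhs_nbhs.
split; last exact: Hy.
apply: open_comp; last exact: discrete_open.
by move=> z _; exact: (@proj_continuous _ (fun _ : site d => discrete_topology A)).
Qed.

(** The sets [agree W x] generate a filter that converges to [x] in every
    coordinate, hence in the product topology; so they form a basis of
    neighbourhoods of [x]. *)
Lemma agree_nbhs U x : open U -> U x -> exists W, agree W x `<=` U.
Proof.
move=> oU Ux; pose B := filter_from [set: {fset site d}] (fun W => agree W x).
have BF : Filter B.
  apply: filter_fromT_filter; first by exists fset0.
  move=> W V; exists (W `|` V)%fset => y H.
  by split=> n nW; apply: H; rewrite inE nW ?orbT.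
have cv : B --> (x : config d A).
  apply/cvg_sup => i Q /= [_ [[C _ <-] Cx CQ]].
  by exists [fset i]%fset => // y /(_ i (fset11 i)) yi; apply: CQ; rewrite /= yi.
by have [W _ WU] := cv U (open_nbhs_nbhs (conj oU Ux)); exists W.
Qed.

Lemma measurable_agree W x : measurable (agree W x : set (borel_config d A)).
Proof. by apply: sub_sigma_algebra; exact: open_agree. Qed.

Lemma local_bigcup W E : local W E ->
  E = \bigcup_(f in [set f : {ffun W -> A} | E (ext f)]) agree W (ext f).
Proof.
move=> lE; apply/seteqP; split=> y.
  move=> Ey; pose f := [ffun k : W => y (val k)].
  have yf n : n \in W -> y n = ext f n.
    by move=> nW; rewrite -[n]/(val [` nW]%fset) ext_val ffunE.
  by exists f => //=; apply: lE Ey.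
by move=> [f /= Ef yf]; apply: lE Ef => n nW; rewrite yf.
Qed.

Lemma local_measurable W E : local W E -> measurable (E : set (borel_config d A)).
Proof.
move=> lE; rewrite (local_bigcup lE); apply: fin_bigcup_measurable => [|f _].
  exact: finite_finset.
exact: measurable_agree.
Qed.

Lemma localS W V E : {subset W <= V} -> local W E -> local V E.
Proof. by move=> WV lE x y xy; apply: lE => n /WV; exact: xy. Qed.

Lemma local_agree W x : local W (agree W x).
Proof. by move=> y z yz yx n nW; rewrite -yz // yx. Qed.

Section Measure.
Variables (R : realType) (mu : probability (borel_config d A) R).

Definition prob E : R := fine (mu E).
Definition weight W x : R := prob (agree W x).

Lemma prob_ge0 E : 0 <= prob E.
Proof. by apply: fine_ge0; exact: measure_ge0. Qed.

Lemma weight_ext W x y : agree W y x -> weight W x = weight W y.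
Proof.
move=> xy; congr prob; apply/seteqP; split=> z zx n nW; rewrite zx //; last exact/esym/xy.
exact: xy.
Qed.

(** Turns the probabilities of local events into finite sums over patterns, in
    which all later estimates are made. *)
Lemma prob_local W E : local W E ->
  prob E = \sum_(f : {ffun W -> A} | `[< E (ext f) >]) weight W (ext f).
Proof.
move=> lE; rewrite /prob {1}(local_bigcup lE).
rewrite measure_fin_bigcup; last first.
- by move=> f _; exact: measurable_agree.
- move=> f g _ _ [y [yf yg]]; apply/ffunP => k.
  by rewrite -!ext_val -yf ?yg //; exact: valP.
- exact: finite_finset.
rewrite fsbig_finite; last exact: finite_finset.
rewrite /weight /prob sum_fine => [|f _]; last by apply: fin_num_measure; exact: measurable_agree.
congr fine; rewrite -[RHS]big_filter.
apply: perm_big; apply: uniq_perm; rewrite ?filter_uniq ?index_enum_uniq ?fset_uniq //.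
move=> f; rewrite mem_filter mem_index_enum andbT in_fset_set; last exact: finite_finset.
by apply/idP/asboolP; rewrite inE.
Qed.

Lemma local_setT W : local W setT. Proof. by []. Qed.

Lemma sum_weight W : \sum_(f : {ffun W -> A}) weight W (ext f) = 1.
Proof.
have := @prob_local W setT; rewrite /prob probability_setT => /(_ (fun _ _ _ _ => I)) /= ->.
by apply: eq_bigl => f; apply/esym/asboolP.
Qed.

Lemma prob_le W V E E' : local W E -> local V E' -> E `<=` E' -> prob E <= prob E'.
Proof.
move=> lE lE' EE'; apply: fine_le; rewrite ?fin_num_measure //.
- exact: local_measurable lE.
- exact: local_measurable lE'.
- by apply: le_measure; rewrite ?inE //; [exact: local_measurable lE|exact: local_measurable lE'].
Qed.

Lemma weight_le W V x : {subset W <= V} -> weight V x <= weight W x.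
Proof.
move=> WV; apply: (prob_le (@local_agree V x) (@local_agree W x)).
by move=> y yx n /WV; exact: yx.
Qed.

Lemma weight_le1 W x : weight W x <= 1.
Proof.
apply: le_trans (prob_le (@local_agree W x) (@local_setT W) (@subsetT _ _)) _.
by rewrite /prob probability_setT.
Qed.

Lemma weight_gt0 W x : (0 < weight W x) = (0 < mu (agree W x))%E.
Proof.
rewrite /weight /prob -lte_fin fineK // fin_num_measure //.
exact: measurable_agree.
Qed.

Lemma mu_agree W x : mu (agree W x) = (weight W x)%:E.
Proof. by rewrite fineK // fin_num_measure //; exact: measurable_agree. Qed.

(** Cylinders are a clopen basis of neighbourhoods: a null cylinder can be
    removed from the support, and a point off a closed set of full measure has
    a null cylinder around it. *)
Lemma suppE x : supp mu x <-> forall W, 0 < weight W x.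
Proof.
split=> [sx W|pos C [[Ccl C1] _]].
  rewrite lt_neqAle prob_ge0 andbT eq_sym; apply/negP => /eqP w0.
  have := sx (~` agree W x); case; last by [].
  split; last exact: sub0set.
  split; first exact/open_closedC/open_agree.
  rewrite probability_setC; last exact: measurable_agree.
  by rewrite mu_agree w0 sube0.
apply: contrapT => Cx.
have [W WC] := agree_nbhs (closed_openC Ccl) Cx.
have := pos W; rewrite weight_gt0; apply/negP; rewrite -leNgt.
have mC : measurable (C : set (borel_config d A)).
  by rewrite -(setCK C); apply: measurableC; apply: sub_sigma_algebra; exact: closed_openC.
have <- : mu (~` C) = 0%E.
  by rewrite probability_setC // C1 subee.
apply: le_measure; rewrite ?inE //; first exact: measurable_agree.
exact: measurableC.
Qed.

(** The configurations having a null cylinder form a countable union of null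
    events, one for each centered box, so almost every configuration is in the
    support. *)
Lemma weight_supp W x : 0 < weight W x -> exists2 y, supp mu y & agree W x y.
Proof.
move=> pos.
pose null N := [set y | weight (centered_box d N) y = 0].
have lnull N : local (centered_box d N) (null N).
  by move=> y z yz; rewrite /null /= => <-; apply: weight_ext => n nB; rewrite yz.
have null0 N : mu (null N) = 0%E.
  have : prob (null N) = 0.
    rewrite (prob_local (lnull N)) big1 // => f Ef.
    by move: Ef => /asboolP.
  move=> p0; rewrite -[LHS]fineK -/(prob _); first by rewrite p0.
  by rewrite fin_num_measure //; exact: local_measurable (lnull N).
have neg : mu.-negligible (\bigcup_N null N : set (borel_config d A)).
  by apply: negligible_bigcup => N; exists (null N); split=> //;
    [exact: local_measurable (lnull N)|exact: null0].
apply: contrapT => no.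
have sub : agree W x `<=` \bigcup_N null N.
  move=> y yx; apply: contrapT => nn; apply: no; exists y => //.
  apply/suppE => V; have [N VN] := in_some_box V.
  apply: lt_le_trans (weight_le y VN); rewrite lt_neqAle prob_ge0 andbT eq_sym.
  by apply/negP => /eqP w0; apply: nn; exists N.
have [B [mB B0 nB]] := neg.
have : (mu (agree W x) <= mu B)%E.
  by apply: le_measure; rewrite ?inE //; [exact: measurable_agree|apply: subset_trans nB].
by rewrite B0 leNgt -weight_gt0 pos.
Qed.

End Measure.
End LocalEvents.

(** * The Markov property and shift-invariance for cylinder weights *)
Section MarkovWeights.
Variables (d : nat) (A : finPointedType) (R : realType).
Variable mu : probability (borel_config d A) R.
Implicit Types (x y z : config d A) (W V F B : {fset site d}) (E : set (config d A)).

Lemma agreeI F B x : agree F x `&` agree B x = agree (F `|` B)%fset x.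
Proof.
apply/seteqP; split=> y.
  by move=> [yF yB] n; rewrite inE => /orP[/yF|/yB].
by move=> H; split=> n nW; apply: H; rewrite inE nW ?orbT.
Qed.

Lemma cond_prob_restr F B x :
  cond_prob mu (cylinder (restr x F)) (cylinder (restr x B)) =
  weight mu (F `|` B)%fset x / weight mu B x.
Proof. by rewrite /cond_prob !cylinder_restr agreeI. Qed.

Lemma restr_restrictf x B V : (V `<=` B)%fset -> (restr x B).[& V]%fmap = restr x V.
Proof.
move=> VB; apply/fmapP => n; rewrite fnd_restrict.
have [nV|nV] := boolP (n \in V); last by rewrite not_fnd.
by rewrite !in_fnd ?(fsubsetP VB) // => nB; rewrite !ffunE.
Qed.

Section Markov.
Hypothesis mrf : markov_random_field mu.

Lemma markov_weight F B x :
  (boundary F `<=` B)%fset -> [disjoint F & B]%fset -> 0 < weight mu B x ->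
  weight mu (F `|` B)%fset x / weight mu B x =
  weight mu (F `|` boundary F)%fset x / weight mu (boundary F) x.
Proof.
move=> FB dFB; rewrite weight_gt0 => pos.
have := mrf (a := restr x F) (b := restr x B) FB dFB.
rewrite cylinder_restr => /(_ pos).
rewrite (restr_restrictf x (V := boundary F) FB).
by rewrite -!cylinder_restr !cond_prob_restr.
Qed.

Lemma disjoint_boundary F : [disjoint F & boundary F]%fset.
Proof.
apply/fdisjointP => n nF; apply/negP => /mem_boundary[].
by rewrite nF.
Qed.

Lemma boundary_subD F W : (boundary F `<=` W)%fset -> (boundary F `<=` W `\` F)%fset.
Proof.
move=> bW; apply/fsubsetP => n nb; rewrite inE (fsubsetP bW) // andbT.
by apply: contraL nb => nF; move/fdisjointP: (disjoint_boundary F); exact.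
Qed.

(** With [B := W] minus [F], the factor [weight mu B] and the weight on the
    boundary of [F] are the same for [x] and [y], so the Markov property leaves
    the ratio of the weights on [F] and its boundary.  The identity is stated
    without division since the weights of [y] may vanish. *)
Lemma weight_ratio F W x y : (F `|` boundary F `<=` W)%fset ->
  (forall V, 0 < weight mu V x) -> (forall n, n \notin F -> x n = y n) ->
  weight mu W y * weight mu (F `|` boundary F)%fset x =
  weight mu W x * weight mu (F `|` boundary F)%fset y.
Proof.
move=> FW pos xy.
have dF := disjoint_boundary F.
pose B := (W `\` F)%fset.
have WE : W = (F `|` B)%fset.
  apply/fsetP => n; rewrite !inE; case: (boolP (n \in F)) => //= nF.
  by apply: (fsubsetP FW); rewrite inE nF.
have bB : (boundary F `<=` B)%fset.
  by apply: boundary_subD; apply: fsubset_trans FW; exact: fsubsetUr.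
have dB : [disjoint F & B]%fset by apply/fdisjointP => n nF; rewrite !inE nF.
have eB : weight mu B y = weight mu B x.
  by apply: weight_ext => n; rewrite !inE => /andP[/xy].
have eb : weight mu (boundary F) y = weight mu (boundary F) x.
  apply: weight_ext => n nb; apply/esym/xy.
  by apply: contraL nb => nF; move/fdisjointP: dF; exact.
have posBy : 0 < weight mu B y by rewrite eB.
have := markov_weight bB dB (pos B); have := markov_weight bB dB posBy.
rewrite -WE eB eb => /(canRL (divfK (lt0r_neq0 (pos B)))) ->.
move=> /(canRL (divfK (lt0r_neq0 (pos B)))) ->.
by ring.
Qed.

(** By the Markov property the weight of the patched configuration on a large
    window is the weight of [x] off [F] times a conditional probability that
    is positive because [y] is in the support. *)
Lemma supp_patch F x y : supp mu x -> supp mu y ->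
  (forall n, n \in boundary F -> x n = y n) ->
  supp mu ((fun n => if n \in F then y n else x n) : config d A).
Proof.
move=> /suppE px /suppE py xy; set z := fun n => _.
apply/suppE => W.
pose B := ((W `|` boundary F) `\` F)%fset.
have bB : (boundary F `<=` B)%fset by apply: boundary_subD; exact: fsubsetUr.
have dB : [disjoint F & B]%fset by apply/fdisjointP => n nF; rewrite !inE nF.
have WB : {subset W <= (F `|` B)%fset} by move=> n nW; rewrite !inE nW; case: (_ \in F).
apply: lt_le_trans (weight_le mu z WB).
have eB : weight mu B z = weight mu B x.
  by apply: weight_ext => n; rewrite !inE /z => /andP[/negPf ->].
have eb : weight mu (boundary F) z = weight mu (boundary F) y.
  by apply: weight_ext => n nb; rewrite /z; case: ifP => // _; exact: xy.
have eF : weight mu (F `|` boundary F)%fset z = weight mu (F `|` boundary F)%fset y.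
  by apply: weight_ext => n; rewrite /z !inE; case: ifP => //= _; exact: xy.
have posB : 0 < weight mu B z by rewrite eB.
have := markov_weight bB dB posB; rewrite eb eF eB.
move=> /(canRL (divfK (lt0r_neq0 (px B)))) ->.
by rewrite mulr_gt0 ?divr_gt0.
Qed.

End Markov.

Section Shift.
Hypothesis mu_shift : shift_invariant mu.

Definition translate W n : {fset site d} := [fset (m + n)%R | m in W]%fset.

Lemma mem_translate W n m : (m \in translate W n) = (m - n \in W).
Proof.
apply/imfsetP/idP => [[k /= kW ->]|mW]; first by rewrite addrK.
by exists (m - n) => //; rewrite subrK.
Qed.

Lemma shift_preimage n E : Defs.shift n @` (Defs.shift n @^-1` E) = E.
Proof.
apply/seteqP; split=> [y [x Ex <-]//|y Ey].
have e : Defs.shift n (Defs.shift (- n) y) = y.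
  by apply/funext => m; rewrite /Defs.shift addrK.
by exists (Defs.shift (- n) y) => //; rewrite /preimage /= e.
Qed.

Lemma local_shift W n E : local W E -> local (translate W n) (Defs.shift n @^-1` E).
Proof.
move=> lE x y xy; apply: lE => m mW; apply: xy.
by rewrite mem_translate addrK.
Qed.

Lemma prob_shift W n E : local W E -> prob mu (Defs.shift n @^-1` E) = prob mu E.
Proof.
move=> lE; rewrite /prob -{2}(shift_preimage n E) mu_shift //.
exact: (local_measurable (local_shift (n := n) lE)).
Qed.

Lemma weight_translate W n x : weight mu (translate W n) x = weight mu W (Defs.shift n x).
Proof.
rewrite -[RHS](prob_shift n (@local_agree _ _ W (Defs.shift n x))); congr prob.
apply/seteqP; split=> y H m mW.
  by rewrite /Defs.shift; apply: H; rewrite mem_translate addrK.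
by rewrite -[m](subrK n); apply: H; rewrite -mem_translate.
Qed.

End Shift.

Lemma mem_boundary1 (n m : site d) : (m \in boundary [fset n]%fset) = adj n m.
Proof.
apply/idP/idP => [/mem_boundary[_ [k]]|nm]; first by rewrite inE => /eqP ->.
apply/mem_boundary; split; first by rewrite inE eq_sym adj_neq.
by exists n => //; rewrite inE.
Qed.

Lemma adjDl (n m k : site d) : adj (n + m) k = adj n (k - m).
Proof. by rewrite -(adjDr (- m)) addrK. Qed.

Lemma boundary1_translate (n : site d) :
  boundary [fset n]%fset = translate (boundary [fset (0 : site d)]%fset) n.
Proof.
by apply/fsetP => m; rewrite mem_translate !mem_boundary1 -adjDl add0r.
Qed.

Definition ball1 (n : site d) : {fset site d} := ([fset n] `|` boundary [fset n])%fset.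

Lemma ball1_translate (n : site d) : ball1 n = translate (ball1 0) n.
Proof.
apply/fsetP => m; rewrite mem_translate !inE -mem_translate -boundary1_translate.
by rewrite subr_eq0.
Qed.

End MarkovWeights.

(** * Flip rates and edge energies *)
Section Potential.
Variables (R : realType) (r : nat).

Lemma cyclic_primitive (c : 'Z_r -> R) : \sum_k c k = 0 ->
  exists v : 'Z_r -> R, forall k, v k - v (k - 1) = c k.
Proof.
move=> c0; exists (fun k : 'Z_r => \sum_(j : 'Z_r | (j <= k)%N) c j) => k.
have [k0|kn0] := eqVneq (k : nat) 0%N.
  have -> : \sum_(j : 'Z_r | (j <= (k - 1)%R)%N) c j = 0.
    rewrite -[RHS]c0; apply: eq_bigl => j.
    have -> : k = 0 by apply: val_inj.
    rewrite sub0r -ltnS; apply: leq_trans (ltn_ord j) _ => /=.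
    by rewrite modn_small // modn_small.
  rewrite subr0 (bigD1 k) //= big1 ?addr0 // => j /andP[].
  by rewrite k0 leqn0 -val_eqE /= k0 => /eqP ->.
have vk1 : (k - 1 : 'Z_r) = k.-1 :> nat.
  rewrite -[in LHS](valZpK k) -Zp_nat -[in LHS](prednK (n := k)) ?lt0n //.
  rewrite -natr1 addrK Zp_nat /= modn_small //.
  by apply: leq_ltn_trans (ltn_ord k); exact: leq_pred.
rewrite vk1 (bigD1 k) //= [X in _ + X - _](_ : _ = \sum_(j : 'Z_r | (j <= k.-1)%N) c j).
  by rewrite addrK.
apply: eq_bigl => j; rewrite -val_eqE /=; move: kn0; lia.
Qed.

(** The constant [gamma] is the obstruction to [c] being a cyclic difference,
    namely half the mean of [c].  If some value of [c] is not prescribed, it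
    can be chosen so that the mean vanishes. *)
Lemma cyclic_decomposition (c : 'Z_r -> R) (pos : pred 'Z_r) (N : R) : N != 0 ->
  exists v gamma, (forall k, pos k -> c k = 2 * gamma + N * (v k - v (k - 1))) /\
    (gamma != 0 -> forall k, pos k).
Proof.
move=> N0.
have solve (c' : 'Z_r -> R) : \sum_k c' k = 0 ->
    exists v, forall k, c' k = N * (v k - v (k - 1)).
  move=> c0; have [|v vE] := @cyclic_primitive (fun k => c' k / N).
    by rewrite -big_distrl /= c0 mul0r.
  by exists v => k; rewrite vE mulrC divfK.
have [allpos|npos] := pselect (forall k, pos k).
  pose g := (\sum_k c k) / (2 * #|'Z_r|%:R).
  have r0 : #|'Z_r|%:R != 0 :> R by rewrite pnatr_eq0 card_ord.
  have [|v vE] := solve (fun k => c k - 2 * g).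
    rewrite sumrB sumr_const -mulr_natr /g; field.
    by rewrite r0.
  by exists v, g; split=> // k _; rewrite -vE addrC subrK.
have [k0 k0neg] : exists k, ~~ pos k.
  by apply: contrapT => no; apply: npos => k; apply/negPn/negP => ?; apply: no; exists k.
have [|v vE] := solve (fun k => if k == k0 then - \sum_(j | j != k0) c j else c k).
  rewrite (bigD1 k0) //= eqxx [X in _ + X](_ : _ = \sum_(j | j != k0) c j) ?addNr //.
  by apply: eq_bigr => j /negPf ->.
exists v, 0; split=> [k kpos|]; last by rewrite eqxx.
by rewrite mulr0 add0r -vE; case: eqP kpos k0neg => // -> ->.
Qed.

End Potential.

Lemma ler_sum_fsubset (R : numDomainType) (K : choiceType) (C W : {fset K}) (f : K -> R) :
  (C `<=` W)%fset -> (forall k, 0 <= f k) -> \sum_(k <- C) f k <= \sum_(k <- W) f k.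
Proof.
move=> CW f0; rewrite (eq_big_seq (fun k => if k \in C then f k else 0)); last by move=> k ->.
rewrite (big_fset_incl _ CW) => [|k _ /negPf -> //].
by apply: ler_sum => k _; case: ifP.
Qed.

Section PairEnergy.
Variables (R : realType) (d r : nat).
Implicit Types (x y : config d 'Z_r) (W : {fset site d}) (v : 'Z_r -> R).

(** Each edge inside [W] whose spins are [k] and [k + 1] contributes [v k]; as
    2 is not 0 modulo r, exactly one of its two orientations is counted. *)
Definition pair_energy v W x : R :=
  \sum_(n <- W) \sum_(m <- W | adj n m && (x m == x n + 1)) v (x n).

Definition degree : nat := #|` boundary [fset (0 : site d)]%fset|.

Lemma degreeE n : #|` boundary [fset (n : site d)]%fset| = degree.
Proof. by rewrite boundary1_translate card_imfset //= => a b /addIr. Qed.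

Lemma degree_gt0 : (0 < d)%N -> (0 < degree)%N.
Proof.
move=> d0; rewrite cardfs_gt0; apply/fset0Pn.
exists (0 + dirv (Ordinal d0, false)).
by rewrite mem_boundary1 adj_dirv.
Qed.

Lemma sum_neighbours W n (a : R) : (boundary [fset n] `<=` W)%fset ->
  \sum_(m <- W) (if adj n m then a else 0) = degree%:R * a.
Proof.
move=> nW; rewrite -(big_fset_incl _ nW) => [|m _]; last first.
  by rewrite mem_boundary1 => /negPf ->.
rewrite (eq_big_seq (fun=> a)) => [|m]; last by rewrite mem_boundary1 => ->.
by rewrite big_const_seq count_predT iter_addr_0 degreeE mulr_natl.
Qed.

Lemma double_sum_row_col W n (e : site d -> site d -> R) : n \in W -> e n n = 0 ->
  \sum_(a <- W) \sum_(b <- W) e a b =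
  \sum_(b <- W) e n b + \sum_(a <- W) e a n +
  \sum_(a <- W | a != n) \sum_(b <- W | b != n) e a b.
Proof.
move=> nW e0; rewrite (bigD1_seq n) ?fset_uniq //= -addrA; congr (_ + _).
rewrite [X in _ = X + _](bigD1_seq n) ?fset_uniq //= e0 add0r -big_split /=.
by apply: eq_bigr => a an; rewrite (bigD1_seq n) ?fset_uniq.
Qed.

(** Before the flip the edges at [n] carry the pair [k - 1], [k] and contribute
    [v (k - 1)] each; afterwards they carry [k], [k + 1] and contribute [v k]
    each.  No other edge changes. *)
Lemma flip_energy v W n x y k : (1 + 1 : 'Z_r) != 0 ->
  (ball1 n `<=` W)%fset -> (forall m, m != n -> x m = y m) ->
  (forall m, adj n m -> x m = k) -> x n = k - 1 -> y n = k + 1 ->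
  pair_energy v W y - pair_energy v W x = degree%:R * (v k - v (k - 1)).
Proof.
move=> two nW xy xk xn yn.
have yk m : adj n m -> y m = k by move=> nm; rewrite -xy ?xk // eq_sym adj_neq.
have nn : n \in W by apply: (fsubsetP nW); rewrite !inE eqxx.
have bW : (boundary [fset n] `<=` W)%fset by apply: fsubset_trans nW; exact: fsubsetUr.
have kk2 (a : 'Z_r) : (a == a + 1 + 1) = false.
  by rewrite -addrA -subr_eq0 opprD addNKr oppr_eq0 (negPf two).
pose e x a b := if adj a b && (x b == x a + 1) then v (x a) else 0.
have eE z : pair_energy v W z = \sum_(a <- W) \sum_(b <- W) e z a b.
  by apply: eq_bigr => a _; rewrite big_mkcond.
have enn z : e z n n = 0 by rewrite /e; case: (boolP (adj n n)) => // /adj_neq; rewrite eqxx.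
rewrite !eE !(double_sum_row_col nn) ?enn //.
rewrite [X in _ + _ + X - _](_ : _ = \sum_(a <- W | a != n) \sum_(b <- W | b != n) e x a b); last first.
  by apply: eq_bigr => a an; apply: eq_bigr => b bn; rewrite /e !xy.
have -> : \sum_(b <- W) e y n b = 0.
  apply: big1 => b _; rewrite /e; case: (boolP (adj n b)) => //= nb.
  by rewrite (yk _ nb) yn kk2.
have -> : \sum_(a <- W) e x a n = 0.
  apply: big1 => a _; rewrite /e; case: (boolP (adj a n)) => //= an.
  by move: an; rewrite adjC => /xk ->; rewrite xn -(inj_eq (addIr 1)) subrK kk2.
have -> : \sum_(b <- W) e x n b = degree%:R * v (k - 1).
  rewrite -(sum_neighbours _ bW); apply: eq_bigr => b _.
  by rewrite /e; case: (boolP (adj n b)) => //= nb; rewrite (xk _ nb) xn subrK eqxx.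
have -> : \sum_(a <- W) e y a n = degree%:R * v k.
  rewrite -(sum_neighbours _ bW); apply: eq_bigr => a _.
  by rewrite /e adjC; case: (boolP (adj n a)) => //= na; rewrite (yk _ na) yn eqxx.
ring.
Qed.

Lemma pair_energy_patch v F W x y :
  (F `|` boundary F `<=` W)%fset -> (forall n, n \notin F -> x n = y n) ->
  pair_energy v W y - pair_energy v W x =
  pair_energy v (F `|` boundary F)%fset y - pair_energy v (F `|` boundary F)%fset x.
Proof.
set V := (_ `|` _)%fset => VW xy.
pose e x a b := if adj a b && (x b == x a + 1) then v (x a) else 0.
have eE U z : pair_energy v U z = \sum_(a <- U) \sum_(b <- U) e z a b.
  by apply: eq_bigr => a _; rewrite big_mkcond.
rewrite !eE -!sumrB.
under eq_bigr do rewrite -sumrB.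
under [in RHS]eq_bigr do rewrite -sumrB.
have nb a b : adj a b -> a \in F -> b \in V.
  move=> ab aF; rewrite inE; case: (boolP (b \in F)) => //= bF.
  by apply/mem_boundary; split=> //; exists a.
have out a b : ~~ ((a \in V) && (b \in V)) -> e y a b - e x a b = 0.
  rewrite /e; case: (boolP (adj a b)) => [ab|_]; last by rewrite subrr.
  move=> ab'; have aF : a \notin F.
    by apply: contra ab' => aF; rewrite (nb a b) // inE aF.
  have bF : b \notin F.
    by apply: contra ab' => bF; rewrite (nb b a) ?inE ?bF // adjC.
  by rewrite !xy // subrr.
rewrite -(big_fset_incl _ VW) => [|a _ aV]; last first.
  by apply: big1 => b _; apply: out; rewrite negb_and aV.
apply: eq_bigr => a _; rewrite -(big_fset_incl _ VW) // => b _ bV.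
by apply: out; rewrite negb_and bV orbT.
Qed.

(** A bound linear in the size of the window, whatever the configuration: this
    is the order of magnitude that a height drift beats. *)
Lemma pair_energy_bound v : exists2 C : R, 0 <= C &
  forall W x, `|pair_energy v W x| <= C * #|` W|%:R.
Proof.
pose V := \sum_k `|v k|.
have V0 : 0 <= V by apply: sumr_ge0.
have vV k : `|v k| <= V by rewrite /V (bigD1 k) //= lerDl sumr_ge0.
exists (degree%:R * V) => [|W x]; first by rewrite mulr_ge0.
rewrite [leRHS](_ : _ = \sum_(n <- W) degree%:R * V); last first.
  by rewrite big_const_seq count_predT iter_addr_0 mulr_natr.
apply: le_trans (ler_norm_sum _ _ _) _; apply: ler_sum => n _.
apply: le_trans (ler_norm_sum _ _ _) _.
rewrite -(sum_neighbours V (fsubsetUr W (boundary [fset n]%fset))).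
apply: le_trans (ler_sum_fsubset (fsubsetUl _ _) _); last by move=> m; case: ifP.
rewrite big_mkcond /=; apply: ler_sum => m _.
by case: (adj n m) => //=; case: ifP.
Qed.

End PairEnergy.

(** * The cocycle of a Markov measure on height configurations *)
Section Cocycle.
Variables (R : realType) (d r : nat) (mu : probability (borel_config d 'Z_r) R).
Hypotheses (d1 : (1 < d)%N) (two_neq0 : (1 + 1 : 'Z_r) != 0).
Hypotheses (mu_shift : shift_invariant mu) (mrf : markov_random_field mu).
Hypothesis mu_adapted : adapted mu (X_ d r).
Implicit Types (x y z : config d 'Z_r) (W F : {fset site d}) (h g : site d -> int).

Definition star (k a : 'Z_r) : config d 'Z_r := fun m => if m == 0 then a else k.

Definition star_weight k a : R := weight mu (ball1 0) (star k a).

Definition flippable k := (0 < star_weight k (k + 1)) && (0 < star_weight k (k - 1)).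

(** The logarithmic gain of probability when a site surrounded by the spin [k]
    moves from [k - 1] to [k + 1].  It is meaningful when [flippable k]. *)
Definition flip_rate k : R := ln (star_weight k (k + 1)) - ln (star_weight k (k - 1)).

Lemma weight_star x n k : (forall m, adj n m -> x m = k) ->
  weight mu (ball1 n) x = star_weight k (x n).
Proof.
move=> xk; rewrite ball1_translate weight_translate //.
apply: weight_ext => m; rewrite !inE mem_boundary1 /star /Defs.shift.
case: eqVneq => [-> _|m0 /= adj0]; first by rewrite add0r.
by apply: xk; rewrite -[n in adj n _]add0r adjDr.
Qed.

Lemma ln_weight_flip W n x y k :
  supp mu x -> supp mu y -> (ball1 n `<=` W)%fset -> (forall m, m != n -> x m = y m) ->
  (forall m, adj n m -> x m = k) -> x n = k - 1 -> y n = k + 1 ->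
  flippable k /\ ln (weight mu W y) - ln (weight mu W x) = flip_rate k.
Proof.
move=> /suppE px /suppE py nW xy xk xn yn.
have yk m : adj n m -> y m = k by move=> nm; rewrite -xy ?xk // eq_sym adj_neq.
have wx : weight mu (ball1 n) x = star_weight k (k - 1) by rewrite (weight_star xk) xn.
have wy : weight mu (ball1 n) y = star_weight k (k + 1) by rewrite (weight_star yk) yn.
have sx : 0 < star_weight k (k - 1) by rewrite -wx; exact: px.
have sy : 0 < star_weight k (k + 1) by rewrite -wy; exact: py.
split; first by rewrite /flippable sx sy.
have := weight_ratio mrf (F := [fset n]%fset) nW px (y := y).
rewrite wx wy => ratio.
have {}ratio : weight mu W y * star_weight k (k - 1) = weight mu W x * star_weight k (k + 1).
  by apply: ratio => m; rewrite inE => /xy.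
have := congr1 (@ln R) ratio.
rewrite lnM ?posrE; [|exact: py|exact: sx].
rewrite lnM ?posrE; [|exact: px|exact: sy].
by rewrite /flip_rate; lra.
Qed.

Lemma supp_flip h n v : height_functions d h -> height_functions d (upd h n v) ->
  supp mu (mod_map r h) <-> supp mu (mod_map r (upd h n v)).
Proof.
move=> hh hu.
have fin : finite_set [set m | mod_map r h m <> mod_map r (upd h n v) m].
  apply: (@sub_finite_set _ _ [set n]); last exact: finite_set1.
  by move=> m /=; rewrite /mod_map /upd; case: eqVneq.
have [_ ad] := mu_adapted; split=> s.
  by apply: ad s _; split=> //=; [exists h|exists (upd h n v)].
apply: ad s _; split=> //=; [by exists (upd h n v)|by exists h|].
by apply: sub_finite_set fin => m /= /nesym.
Qed.

Variables (v : 'Z_r -> R) (gamma : R).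
Hypothesis rateE : forall k, flippable k ->
  flip_rate k = 2 * gamma + (degree d)%:R * (v k - v (k - 1)).

(** Both sides are additive along sequences of flips, so it suffices to treat
    one flip at height [k]: the left side changes by [flip_rate k], the sum of
    heights by 2 and the energy as in [flip_energy]. *)
Lemma cocycle_formula h g F W : height_functions d h -> height_functions d g ->
  (exists a, a \notin F) -> (forall m, m \notin F -> h m = g m) ->
  (F `|` boundary F `<=` W)%fset -> supp mu (mod_map r h) ->
  supp mu (mod_map r g) /\
  ln (weight mu W (mod_map r g)) - ln (weight mu W (mod_map r h)) =
  gamma * (\sum_(n <- W) (g n - h n))%:~R
  + (pair_energy v W (mod_map r g) - pair_energy v W (mod_map r h)).
Proof.
move=> hh hg Fco hgF FW.
pose T h g := (supp mu (mod_map r h) <-> supp mu (mod_map r g)) /\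
  (supp mu (mod_map r h) ->
  ln (weight mu W (mod_map r g)) - ln (weight mu W (mod_map r h)) =
  gamma * (\sum_(n <- W) (g n - h n))%:~R
  + (pair_energy v W (mod_map r g) - pair_energy v W (mod_map r h))).
suff [eq E] : T h g by move=> s; split; [exact/eq|exact: E].
apply: (@flip_connected _ T F) => //.
- move=> f _; split=> // _; rewrite big1 => [|n _]; last by rewrite subrr.
  by rewrite mulr0z mulr0 !subrr addr0.
- move=> f f' [eq E]; split; first exact: iff_sym.
  move=> /eq /E.
  have -> : \sum_(n <- W) (f n - f' n) = - \sum_(n <- W) (f' n - f n).
    by rewrite -sumrN; apply: eq_bigr => n _; rewrite opprB.
  rewrite mulrNz; lra.
- move=> f1 f2 f3 [eq12 E12] [eq23 E23]; split; first exact: iff_trans eq23.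
  move=> s1; have := E12 s1; have := E23 (proj1 eq12 s1).
  have -> : \sum_(n <- W) (f3 n - f1 n) =
      \sum_(n <- W) (f2 n - f1 n) + \sum_(n <- W) (f3 n - f2 n).
    by rewrite -big_split; apply: eq_bigr => n _; rewrite /= addrC addrA subrK.
  rewrite rmorphD /=; lra.
move=> f n k nF hf hu fk fn; split; first exact: supp_flip.
move=> s; have s' := proj1 (supp_flip hf hu) s.
have nW : (ball1 n `<=` W)%fset.
  apply: fsubset_trans FW; apply/fsubsetP => m; rewrite !inE mem_boundary1.
  case/orP => [/eqP ->|nm]; first by rewrite nF.
  case: (boolP (m \in F)) => //= mF.
  by apply/mem_boundary; split=> //; exists n.
have off m : m != n -> mod_map r f m = mod_map r (upd f n (k + 1)) m.
  by move=> /negPf mn; rewrite /mod_map /upd mn.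
have nbk m : adj n m -> mod_map r f m = k%:~R by move=> /fk; rewrite /mod_map => ->.
have fn' : mod_map r f n = k%:~R - 1 by rewrite /mod_map fn rmorphB.
have un' : mod_map r (upd f n (k + 1)) n = k%:~R + 1.
  by rewrite /mod_map /upd eqxx rmorphD.
have [fl ->] := ln_weight_flip s s' nW off nbk fn' un'.
rewrite rateE // (flip_energy v two_neq0 nW off nbk fn' un'); congr (_ + _).
rewrite (bigD1_seq n) ?fset_uniq //=; last by apply: (fsubsetP nW); rewrite !inE eqxx.
rewrite big1 => [|m /negPf mn]; last by rewrite /upd mn subrr.
have -> : upd f n (k + 1) n - f n + 0 = 2 by rewrite /upd eqxx fn; lia.
by rewrite mulrC.
Qed.

End Cocycle.

(** * Counting events and returns *)
Section CountingEvents.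
Variables (d : nat) (A : finPointedType) (R : realType).
Variable mu : probability (borel_config d A) R.
Implicit Types (x y : config d A) (W : {fset site d}).

Lemma prob_indicator W (E : set (config d A)) : local W E ->
  prob mu E = \sum_(f : {ffun W -> A}) weight mu W (ext f) * (`[< E (ext f) >])%:R.
Proof.
move=> lE; rewrite (prob_local mu lE) big_mkcond; apply: eq_bigr => f _.
by case: asboolP; rewrite ?mulr1 ?mulr0.
Qed.

Lemma common_window (I : finType) (E : I -> set (config d A)) :
  (forall i, exists W, local W (E i)) -> exists W, forall i, local W (E i).
Proof.
move=> /choice[w wE]; exists (\bigcup_(i <- enum I) w i)%fset => i.
apply: localS (wE i) => n nw; apply/bigfcupP; exists i => //.
by rewrite mem_enum.
Qed.

(** Linearity of the expectation, for sums of indicators of local events. *)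
Lemma sum_prob_le (I J : finType) (E : I -> set (config d A))
    (E' : J -> set (config d A)) :
  (forall i, exists W, local W (E i)) -> (forall j, exists W, local W (E' j)) ->
  (forall x, (\sum_i `[< E i x >] <= \sum_j `[< E' j x >])%N) ->
  \sum_i prob mu (E i) <= \sum_j prob mu (E' j).
Proof.
move=> /common_window[W1 l1] /common_window[W2 l2] le.
pose W := (W1 `|` W2)%fset.
have {}l1 i : local W (E i) by apply: localS (l1 i) => n nW; rewrite inE nW.
have {}l2 i : local W (E' i) by apply: localS (l2 i) => n nW; rewrite inE nW orbT.
rewrite (eq_bigr _ (fun i _ => prob_indicator (l1 i))) exchange_big /=.
rewrite [leRHS](eq_bigr _ (fun j _ => prob_indicator (l2 j))) [leRHS]exchange_big /=.
apply: ler_sum => f _; rewrite -!mulr_sumr ler_wpM2l ?prob_ge0 //.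
by rewrite -!natr_sum ler_nat.
Qed.

End CountingEvents.

(** Of the visits in [0, L), those followed by fewer than [K] visits (counting
    themselves) within the next [L] steps are among the last [K] visits. *)
Lemma late_visits (b : nat -> bool) (K L : nat) :
  (\sum_(j < L) (b j && (\sum_(i < L) b (j + i) < K)) <= K)%N.
Proof.
apply: (@leq_trans (\sum_(j < L) (b j && (\sum_(i < L - j) b (j + i) < K)))%N).
  apply: leq_sum => j _; case: (b j) => //=.
  case: ltnP => // lt; rewrite (leq_ltn_trans _ lt) //.
  have widen a c (F : nat -> nat) : (a <= c)%N -> (\sum_(i < a) F i <= \sum_(i < c) F i)%N.
    by move=> /subnKC <-; rewrite big_split_ord /= leq_addr.
  exact: (widen _ _ (fun i => b (j + i)%N : nat) (leq_subr _ _)).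
elim: L b => [|L IH] b; first by rewrite big_ord0.
rewrite big_ord_recl subn0.
rewrite (eq_bigr (fun j : 'I_L =>
  (b j.+1 && (\sum_(i < L - j) b (j.+1 + i)%N < K)%N) : nat)) //.
have := IH (fun j => b j.+1) => /=.
set rest := (X in (X <= K)%N -> _) => restK.
have rest_le : (rest <= \sum_(i < L) b i.+1)%N.
  by apply: leq_sum => i _; case: (b i.+1) => //; case: (_ < _)%N.
case b0: (b 0%N) => /=; last by rewrite add0n.
case: ltnP => /= lt; last by rewrite add0n.
have {}lt : (1 + \sum_(i < L) b i.+1 < K)%N.
  by move: lt; rewrite big_ord_recl addn0 b0; exact.
by apply: leq_trans (ltnW lt); rewrite leq_add2l.
Qed.

Section Recurrence.
Variables (d : nat) (A : finPointedType) (R : realType).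
Variable mu : probability (borel_config d A) R.
Hypothesis mu_shift : shift_invariant mu.

(** Shift-invariance turns [L] times the probability into the expected number
    of positions j in [0, L) at which the event happens after shifting by
    [u *+ j], and this number never exceeds [K] by [late_visits]. *)
Lemma rare_returns (G : set (config d A)) (W : {fset site d}) (u : site d) (K L : nat) :
  local W G ->
  prob mu (G `&` [set x | (\sum_(i < L) `[< G (Defs.shift (u *+ i) x) >] < K)%N]) * L%:R
    <= K%:R.
Proof.
move=> lG; set E := _ `&` _.
have shD (x : config d A) i j : Defs.shift (u *+ i) (Defs.shift (u *+ j) x) = Defs.shift (u *+ (j + i)) x.
  by apply/funext => m; rewrite /Defs.shift -addrA -mulrnDr addnC.
have [W' lE] : exists W', local W' E.
  have [|V lV] := @common_window d A 'I_L.+1 (fun i => Defs.shift (u *+ i) @^-1` G).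
    by move=> i; exists (translate W (u *+ i)); exact: local_shift.
  exists V => x y xy [Gx nx].
  have e (i : 'I_L.+1) : G (Defs.shift (u *+ i) x) <-> G (Defs.shift (u *+ i) y).
    by split; apply: (lV i) => n nV; rewrite xy.
  have s0 (z : config d A) : Defs.shift (u *+ 0) z = z.
    by apply/funext => m; rewrite /Defs.shift mulr0n addr0.
  split; first by move: Gx; rewrite -{1}(s0 x) -(s0 y); exact: (proj1 (e ord0)).
  move: nx => /=; congr (_ < _)%N; apply: eq_bigr => i _; congr nat_of_bool.
  by apply/asboolP/asboolP; have := e (widen_ord (leqnSn L) i) => -[].
pose Ej (j : 'I_L) := Defs.shift (u *+ j) @^-1` E.
have -> : prob mu E * L%:R = \sum_j prob mu (Ej j).
  rewrite (eq_bigr (fun _ => prob mu E)); last first.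
    by move=> j _; exact: (prob_shift mu_shift _ lE).
  by rewrite sumr_const card_ord mulr_natr.
have -> : K%:R = \sum_(j < K) prob mu setT.
  by rewrite sumr_const card_ord /prob probability_setT.
apply: sum_prob_le.
- by move=> i; exists (translate W' (u *+ i)); exact: local_shift.
- by move=> j; exists W'.
move=> x; rewrite [leqRHS](eq_bigr (fun _ => 1%N)); last first.
  by move=> j _; case: asboolP => // -[].
rewrite sum1_card card_ord.
apply: leq_trans (late_visits (fun i => `[< G (Defs.shift (u *+ i) x) >]) K L).
apply: leq_sum => j _; case: asboolP => // -[Gj]; rewrite /Ej /preimage /=.
under eq_bigr do rewrite shD.
by move=> ->; case: asboolP.
Qed.

End Recurrence.

(** * Absence of drift *)
Section Drift.
Variables (R : realType) (d r : nat) (mu : probability (borel_config d 'Z_r) R).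
Hypotheses (d1 : (1 < d)%N) (two_neq0 : (1 + 1 : 'Z_r) != 0).
Hypotheses (mu_shift : shift_invariant mu) (mrf : markov_random_field mu).
Hypothesis mu_adapted : adapted mu (X_ d r).
Variables (v : 'Z_r -> R) (gamma : R).
Hypothesis rateE : forall k, flippable mu k ->
  flip_rate mu k = 2 * gamma + (degree d)%:R * (v k - v (k - 1)).
(* The sign s of gamma lets one argument treat both signs: s times a lift is
   again a height function, and it is the one that tends to be large. *)
Variable s : int.
Hypotheses (s1 : s * s = 1) (gamma_s : 0 < gamma * s%:~R).
Implicit Types (x y z : config d 'Z_r) (W F : {fset site d}) (h g : site d -> int).

Local Notation beta := (gamma * s%:~R).

Lemma heightM h : height_functions d h -> height_functions d (fun n => s * h n).
Proof.
move=> hh; have [->|->] : s = 1 \/ s = -1 by move: s1; nia.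
  by move=> n m /hh; rewrite !mul1r.
by move=> n m /hh; rewrite !mulN1r; lia.
Qed.

(** The number of upward steps along an axis segment, for the height function
    with sign [s]; it can be read off the spins ([rises_mod_map]). *)
Definition rises x (n : site d) e L : nat :=
  \sum_(j < L) (x (n + dirv e *+ j.+1) == x (n + dirv e *+ j) + s%:~R)%R.

Lemma rises_mod_map h n e L : height_functions d h ->
  rises (mod_map r h) n e L = upsteps (fun n => s * h n) n e L.
Proof.
move=> hh; apply: eq_bigr => j _; congr nat_of_bool.
have ab : adj (n + dirv e *+ j) (n + dirv e *+ j.+1).
  by rewrite mulrSr addrA; exact: adj_dirv.
have ba := ab; rewrite adjC in ba.
have := height_adj hh ab.
have [->|->] : s = 1 \/ s = -1 by move: s1; nia.
  by rewrite !mul1r (mod_map_step two_neq0 hh ab).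
rewrite !mulN1r mulrNz eq_sym subr_eq (mod_map_step two_neq0 hh ba).
by case=> ->; do 2 case: eqP => //; lia.
Qed.

(** The cocycle formula compares the configuration with the one obtained by
    replacing [s * h] with [g]; the weight of the latter is at most 1 and the
    energy difference is at most linear in the size of the window. *)
Lemma weight_exp_bound : exists2 C : R, 0 <= C & forall h g F W,
  height_functions d h -> height_functions d g -> (exists a, a \notin F) ->
  (forall m, m \notin F -> g m = s * h m) -> (F `|` boundary F `<=` W)%fset ->
  supp mu (mod_map r h) ->
  weight mu W (mod_map r h) <=
    expR (C * #|` W|%:R - beta * (\sum_(n <- W) (g n - s * h n))%:~R).
Proof.
have [C C0 CE] := pair_energy_bound d v.
exists (2 * C) => [|h g F W hh hg Fco gF FW sx]; first by rewrite mulr_ge0.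
have hsg := heightM hg.
have hgF m : m \notin F -> h m = s * g m by move=> /gF ->; rewrite mulrA s1 mul1r.
have [sy] := cocycle_formula d1 two_neq0 mu_shift mrf mu_adapted rateE
  hh hsg Fco hgF FW sx.
have pos : forall V, 0 < weight mu V (mod_map r h) by apply/suppE.
have posy : forall V, 0 < weight mu V (mod_map r (fun n => s * g n)) by apply/suppE.
have := CE W (mod_map r h); have := CE W (mod_map r (fun n => s * g n)).
have : ln (weight mu W (mod_map r (fun n => s * g n))) <= 0.
  by apply: ln_le0; exact: weight_le1.
have -> : \sum_(n <- W) (s * g n - h n) = s * \sum_(n <- W) (g n - s * h n).
  by rewrite mulr_sumr; apply: eq_bigr => n _; rewrite mulrBr mulrA s1 mul1r.
rewrite rmorphM /= !ler_norml => ly /andP[y1 y2] /andP[x1 x2] E.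
rewrite -[leLHS]lnK ?posrE ?pos // ler_expR; lra.
Qed.

Lemma rises_shift x n e L : rises (Defs.shift n x) 0 e L = rises x n e L.
Proof. by apply: eq_bigr => j _; rewrite /Defs.shift !add0r ![_ + n]addrC. Qed.

Lemma rises_ext W x y n e L : (forall j, (j <= L)%N -> n + dirv e *+ j \in W) ->
  (forall m, m \in W -> x m = y m) -> rises x n e L = rises y n e L.
Proof.
move=> nW xy; apply: eq_bigr => j _.
by rewrite !xy ?nW // ltnW.
Qed.

(* Nested boxes of sides 5 M, 3 M and M with M = d L, at distance M from each
   other: heights are raised in the middle box, sites of the core are at depth M
   in it, and the window contains its boundary. *)
Section Window.
Variable L : nat.
Hypothesis L0 : (0 < L)%N.
Local Notation M := (d * L)%N.
Local Notation window := (box d 0 (5 * M)).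
Local Notation middle := (box d M%:Z (3 * M)).
Local Notation core := (box d (2 * M)%N%:Z M).

Let M0 : (0 < M)%N. Proof. by rewrite muln_gt0 L0 andbT ltnW. Qed.

Lemma core_ball n : n \in core -> forall m, (l1norm (n - m) < M)%N -> m \in middle.
Proof.
move=> /in_box nc m nm; apply/in_box => i; have := nc i.
have := leq_ltn_trans (coord_le_l1norm (n - m) i) nm; rewrite !mxE.
by set p : int := n ord0 i; set q : int := m ord0 i; move: (d * L)%N => k; lia.
Qed.

Lemma core_line n : n \in core ->
  forall e j, (j <= L)%N -> n + dirv e *+ j \in window.
Proof.
move=> /in_box nc e j jL; apply/in_box => i; have := nc i.
have LM : (L <= M)%N by rewrite leq_pmull // ltnW.
have : (absz ((dirv e *+ j) ord0 i) <= j)%N.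
  apply: leq_trans (coord_le_l1norm _ _) _.
  by rewrite dirv_mulrn l1norm_axis; case: e.2; lia.
rewrite [(n + _) _ _]mxE; move: LM; move: (d * L)%N => k.
by set p : int := n ord0 i; set q : int := (dirv e *+ j) ord0 i; lia.
Qed.

Lemma middle_sub_window : (middle `|` boundary middle `<=` window)%fset.
Proof.
apply/fsubsetP => m; rewrite inE => /orP[/in_box mm|/mem_boundary[_ [n /in_box nm adj_nm]]].
  apply/in_box => i; have := mm i; set p : int := m ord0 i.
  by move: (d * L)%N => k; lia.
apply/in_box => i; have := nm i; have := coord_le_l1norm (n - m) i.
rewrite (eqP adj_nm) !mxE; set p : int := m ord0 i; set q : int := n ord0 i.
by move: M0; move: (d * L)%N => k; lia.
Qed.

Lemma core_sub_window : (core `<=` window)%fset.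
Proof.
apply/fsubsetP => m /in_box mm; apply/in_box => i; have := mm i.
by set p : int := m ord0 i; move: (d * L)%N => k; lia.
Qed.

Lemma middle_proper : exists a, a \notin middle.
Proof.
exists 0; apply/negP => /in_box /(_ (Ordinal (ltnW d1))); rewrite mxE.
by move: M0; move: (d * L)%N => k; lia.
Qed.

(** For a pattern of positive weight, [ex] is the gain of the maximal extension
    in the middle box over a lift of the pattern.  Patterns of weight zero carry
    the value 0 so that [ex] can be chosen for all patterns at once. *)
Lemma pattern_excess (C : R) : (forall h g F W,
    height_functions d h -> height_functions d g -> (exists a, a \notin F) ->
    (forall m, m \notin F -> g m = s * h m) -> (F `|` boundary F `<=` W)%fset ->
    supp mu (mod_map r h) ->
    weight mu W (mod_map r h) <=
      expR (C * #|` W|%:R - beta * (\sum_(n <- W) (g n - s * h n))%:~R)) ->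
  forall f : {ffun window -> 'Z_r}, exists ex : site d -> nat,
  [/\ weight mu window (ext f) <=
        expR (C * #|` window|%:R - beta * (\sum_(n <- window) ex n)%N%:R) &
      0 < weight mu window (ext f) -> forall n, n \in core ->
        exists e, (rises (ext f) n e L <= ex n)%N].
Proof.
move=> Cbound f.
have [pos|npos] := boolP (0 < weight mu window (ext f)); last first.
  exists (fun=> 0%N); split=> //.
  by apply: le_trans (expR_ge0 _); rewrite leNgt.
have [x sx xf] := weight_supp pos.
have [h hh xE] : X_ d r x by apply: (proj1 mu_adapted).
subst x.
have [g [hg gF gh low]] := maximal_extension (heightM hh) middle_proper.
exists (fun n => absz (g n - s * h n)%R); split=> [|_ n nc].
  have := Cbound h g _ _ hh hg middle_proper gF middle_sub_window sx.
  rewrite (weight_ext mu xf); congr (_ <= expR (_ - _ * _)).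
  rewrite natr_sum rmorph_sum; apply: eq_bigr => n _.
  by rewrite natr_absz ger0_norm // subr_ge0.
have [e le] := steep_axis (ltnW d1) (heightM hh) hg gh low (core_ball nc).
exists e; rewrite -(rises_ext (x := mod_map r h) (core_line nc e)) //.
by rewrite rises_mod_map //; have := gh n; move: le; lia.
Qed.

End Window.

(** Along every axis direction the height rises at least [K] times within [L]
    steps.  By [steep_axis], shifted to a site deep in a box where heights are
    raised, this event forces a gain of at least [K] at that site. *)
Definition steep L K : set (config d 'Z_r) :=
  [set x | forall e, (K <= rises x 0 e L)%N].

Lemma local_rises (n : site d) L : exists W, forall x y,
  (forall m, m \in W -> x m = y m) -> forall e, rises x n e L = rises y n e L.
Proof.
exists [fset (n + dirv p.1 *+ (p.2 : nat))%R | p : (dir d * 'I_L.+1)%type in predT]%fset.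
move=> x y xy e; apply: rises_ext xy => j jL; apply/imfsetP.
by exists (e, Ordinal (jL : (j < L.+1)%N)).
Qed.

Lemma local_steep L K : exists W, local W (steep L K).
Proof.
have [W WP] := local_rises 0 L; exists W => x y xy sx e.
by rewrite -(WP x y xy).
Qed.

(** The weights [w f] are at most [exp (- T f)] divided by the number of
    patterns, where [T f] is [beta * S f] minus a multiple of the volume; since
    [T <= exp T - 1], the expectation of [T] is at most 0.  So the expected
    total gain is at most a constant times the volume, and the probability that
    the gain at a core site is at least [K] is on average [O(1 / K)].  By
    shift-invariance this probability bounds that of [steep L K]. *)
Lemma prob_steep : exists2 B : R, 0 <= B &
  forall L K, (0 < L)%N -> prob mu (steep L K) * K%:R <= B.
Proof.
have [C C0 Cbound] := weight_exp_bound.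
have q0 : 0 < #|'Z_r|%:R :> R by rewrite ltr0n card_ord.
have q1 : 0 <= ln (#|'Z_r|%:R : R) by rewrite ln_ge0 // ler1n card_ord.
exists ((C + ln #|'Z_r|%:R) * 5 ^+ d / beta) => [|L K L0].
  apply: divr_ge0; last exact: ltW.
  by rewrite mulr_ge0 ?exprn_ge0 ?addr_ge0.
have [ex exP] := choice (pattern_excess L0 Cbound).
set M := (d * L)%N in ex exP *.
set W := box d 0 (5 * M) in ex exP *.
set core := box d _ M in exP.
have M0 : (0 < M)%N by rewrite muln_gt0 L0 andbT ltnW.
have coreW : (core `<=` W)%fset by exact: core_sub_window.
pose w (f : {ffun W -> 'Z_r}) : R := weight mu W (ext f).
pose S f : R := (\sum_(n <- W) ex f n)%N%:R.
pose Q : R := expR (- (#|` W|%:R * ln #|'Z_r|%:R)).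
have nQ : #|{ffun W -> 'Z_r}|%:R * Q = 1.
  rewrite card_ffun -cardfE natrX /Q expRN mulrC expRM_natl lnK ?posrE //.
  by rewrite mulVf // expf_neq0 // lt0r_neq0.
have sumS : \sum_f w f * (beta * S f) <= (C + ln #|'Z_r|%:R) * #|` W|%:R.
  have pointwise f :
      w f * (beta * S f - (C + ln #|'Z_r|%:R) * #|` W|%:R) <= Q - w f.
    set T := (X in w f * X).
    have wT : w f * expR T <= Q.
      apply: (@le_trans _ _ (expR (C * #|` W|%:R - beta * S f) * expR T)).
        by rewrite ler_wpM2r ?expR_ge0 //; have [] := exP f.
      by rewrite -expRD ler_expR /T; lra.
    apply: le_trans (_ : w f * (expR T - 1) <= _); last by rewrite mulrBr mulr1 lerD2r.
    by rewrite ler_wpM2l ?prob_ge0 // lerBrDr addrC expR_ge1Dx.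
  have : \sum_f w f * (beta * S f - (C + ln #|'Z_r|%:R) * #|` W|%:R)
      <= \sum_f (Q - w f).
    by apply: ler_sum => f _; exact: pointwise.
  have sQ : \sum_(f : {ffun W -> 'Z_r}) Q = 1 by rewrite sumr_const -nQ mulr_natl.
  rewrite sumrB sQ sum_weight subrr.
  under eq_bigr do rewrite mulrBr.
  by rewrite sumrB -mulr_suml sum_weight mul1r subr_le0.
have lS n : n \in core -> local W (Defs.shift n @^-1` steep L K).
  move=> nc x y xy; rewrite /preimage /= /steep /= => sx e.
  have := sx e; rewrite !rises_shift.
  by rewrite (rises_ext (core_line L0 nc e) xy).
have pS n : n \in core -> prob mu (steep L K) * K%:R <= \sum_f w f * (ex f n)%:R.
  move=> nc; have [V lV] := local_steep L K.
  rewrite -(prob_shift mu_shift n lV) (prob_indicator mu (lS n nc)) mulr_suml.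
  apply: ler_sum => f _; rewrite -mulrA.
  have [pos|npos] := boolP (0 < w f); last first.
    have -> : weight mu W (ext f) = 0.
      by apply/eqP; rewrite eq_le prob_ge0 andbT leNgt.
    by rewrite mul0r mulr_ge0 ?prob_ge0.
  rewrite ler_wpM2l ?prob_ge0 // -natrM ler_nat.
  have [_ /(_ pos n nc)[e le]] := exP f.
  case: asboolP; last by rewrite mul0n.
  rewrite mul1n /preimage /= /steep /= => /(_ e); rewrite rises_shift => H.
  exact: leq_trans le.
have total : prob mu (steep L K) * K%:R * #|` core|%:R <= \sum_f w f * S f.
  apply: (@le_trans _ _ (\sum_(n <- core) \sum_f w f * (ex f n)%:R)).
    rewrite [leLHS](_ : _ = \sum_(n <- core) prob mu (steep L K) * K%:R); last first.
      by rewrite big_const_seq count_predT iter_addr_0 mulr_natr.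
    by rewrite big_seq [leRHS]big_seq; apply: ler_sum => n; exact: pS.
  rewrite exchange_big; apply: ler_sum => f _.
  by rewrite -mulr_sumr ler_wpM2l ?prob_ge0 // /S natr_sum ler_sum_fsubset.
rewrite ler_pdivlMr //.
have cM : 0 < (M ^ d)%:R :> R by rewrite ltr0n expn_gt0 M0.
rewrite -(ler_pM2r cM).
have cardW : #|` W|%:R = 5 ^+ d * (M ^ d)%:R :> R by rewrite card_box expnMn natrM natrX.
have {}total : prob mu (steep L K) * K%:R * (M ^ d)%:R <= \sum_f w f * S f.
  by move: total; rewrite card_box.
have e : \sum_f w f * (beta * S f) = beta * \sum_f w f * S f.
  by rewrite mulr_sumr; apply: eq_bigr => f _; rewrite mulrCA.
rewrite -[leRHS]mulrA -cardW; apply: le_trans sumS; rewrite e.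
by rewrite mulrAC [leLHS]mulrC ler_pM2l.
Qed.

(** If all flips occur, the origin is a local minimum of the signed height with
    positive probability.  In that event either the origin is [steep], or along
    some axis direction fewer than [K] of the next [L] sites are local minima,
    as each local minimum is followed by a rise.  Both have small probability:
    [B / K] and at most [K / L] for each of the directions. *)
Lemma no_drift : ~ forall k, flippable mu k.
Proof.
move=> /(_ 0) /andP[f1 f2].
pose G := [set x : config d 'Z_r | forall m, adj 0 m -> x m = x 0 + s%:~R].
have lG : local (ball1 0) G.
  move=> x y xy Gx m am.
  have <- : x 0 = y 0 by apply: xy; rewrite !inE eqxx.
  have <- : x m = y m by apply: xy; rewrite !inE mem_boundary1 am orbT.
  exact: Gx.
have G0 : 0 < prob mu G.
  have sub (a : 'Z_r) : a + s%:~R = 0 -> agree (ball1 0) (star 0 a) `<=` G.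
    move=> as0 x xa m am.
    have -> : x m = star 0 a m by apply: xa; rewrite !inE mem_boundary1 am orbT.
    have -> : x 0 = (star 0 a : config d 'Z_r) 0 by apply: xa; rewrite !inE eqxx.
    by rewrite /star eqxx as0 eq_sym (negPf (adj_neq am)).
  have le (a : 'Z_r) : a + s%:~R = 0 -> star_weight mu 0 a <= prob mu G.
    move=> as0; apply: (prob_le mu _ lG (sub a as0)).
    exact: (@local_agree _ _ (ball1 0)).
  have [se|se] : s = 1 \/ s = -1 by move: s1; nia.
    by apply: lt_le_trans f2 (le _ _); rewrite se addrNK.
  by apply: lt_le_trans f1 (le _ _); rewrite se add0r subrr.
have [B B0 steepB] := prob_steep.
pose K := (Num.truncn (2 * B / prob mu G)).+1.
have KB : 2 * B < K%:R * prob mu G.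
  by rewrite -ltr_pdivrMr // truncnS_gt.
pose L := (Num.truncn (2 * (#|{: dir d}|%:R * K%:R) / prob mu G)).+1.
have LK : 2 * (#|{: dir d}|%:R * K%:R) < L%:R * prob mu G.
  by rewrite -ltr_pdivrMr // truncnS_gt.
pose few (e : dir d) := G `&` [set x | (\sum_(i < L) `[< G (Defs.shift (dirv e *+ i) x) >] < K)%N].
have lfew e : exists W, local W (few e).
  have [|W lW] := @common_window d _ 'I_L (fun i => Defs.shift (dirv e *+ i) @^-1` G).
    by move=> i; exists (translate (ball1 0) (dirv e *+ i)); exact: local_shift.
  exists (ball1 0 `|` W)%fset => x y xy [Gx nx].
  split; first by apply: lG Gx => m mb; apply: xy; rewrite inE mb.
  move: nx => /=; congr (_ < _)%N; apply: eq_bigr => i _; congr nat_of_bool.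
  by apply/asboolP/asboolP; apply: (lW i) => m mW; rewrite xy // inE mW orbT.
pose E' (j : 'I_1 + dir d) := if j is inr e then few e else steep L K.
have cover : prob mu G <= \sum_j prob mu (E' j).
  have -> : prob mu G = \sum_(i < 1) prob mu G by rewrite big_ord1.
  apply: sum_prob_le => [_|j|x]; first by exists (ball1 0).
    by case: j => [i|e]; [exact: local_steep|exact: lfew].
  rewrite big_ord1; case: asboolP => //= Gx; rewrite lt0n sum_nat_eq0.
  apply/forallPn; have [[e fe]|nof] := pselect (exists e, few e x).
    by exists (inr e) => /=; case: asboolP.
  exists (inl ord0) => /=; case: asboolP => // nst; exfalso; apply: nst => e.
  rewrite leqNgt; apply/negP => lt; apply: nof; exists e; split=> //=.
  apply: leq_ltn_trans lt; apply: leq_sum => i _; case: asboolP => // Gi.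
  have := Gi (dirv e); rewrite -{1}[dirv e]add0r adj_dirv /Defs.shift.
  by rewrite !add0r -mulrS => /(_ isT) ->; rewrite eqxx.
have fewL e : prob mu (few e) * L%:R <= K%:R by exact: rare_returns lG.
have L0 : (0 < L)%N by [].
have stK := steepB L K L0.
have sumfew : (\sum_e prob mu (few e)) * L%:R <= #|{: dir d}|%:R * K%:R.
  rewrite mulr_suml mulr_natl -sumr_const; apply: ler_sum => e _; exact: fewL.
move: cover; rewrite big_sumType big_ord1 /= => cover.
have K0 : 0 < K%:R :> R by rewrite ltr0n.
have aK : prob mu (steep L K) < prob mu G / 2.
  by rewrite -(ltr_pM2r K0); lra.
have L0' : 0 < L%:R :> R by rewrite ltr0n.
have bL : \sum_e prob mu (few e) < prob mu G / 2.
  by rewrite -(ltr_pM2r L0'); lra.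
move: cover; apply/negP; rewrite -ltNge [ltRHS](splitr (prob mu G)).
exact: ltrD.
Qed.

End Drift.

(** * The nearest neighbour interaction *)
Section Interaction.
Variables (R : realType) (d r : nat) (v : 'Z_r -> R).
Implicit Types (x y : config d 'Z_r) (a b : pattern d 'Z_r) (W C : {fset site d}).

Definition bond (u u' : option 'Z_r) : R :=
  if u is Some k then if u' is Some l then if l == k + 1 then v k else 0 else 0 else 0.

(** The spins are given by a function on all sites rather than by a pattern, so
    that the domain can be rewritten independently of them. *)
Definition edge_sum C (f : site d -> option 'Z_r) : R :=
  if #|` C| == 2%N
  then \sum_(n <- C) \sum_(m <- C | adj n m) bond (f n) (f m) else 0.

(** The value [v k] on a pattern with spins [k] and [k + 1] on an edge, in either
    order, and 0 on every other pattern. *)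
Definition edge_interaction a : R := edge_sum (domf a) (fun n => a.[? n]%fmap).

Lemma adj_pair_diam C n m : #|` C| = 2%N -> n \in C -> m \in C -> adj n m -> diam_le 1 C.
Proof.
move=> C2 nC mC nm p q pC qC.
have CE : C = [fset n; m]%fset.
  apply/eqP; rewrite eq_sym eqEfcard fsubUset !fsub1set nC mC /=.
  by rewrite cardfs2 (adj_neq nm) C2.
have [<-|pq] := eqVneq p q; first by exists [::].
exists [:: q]; split=> //=; rewrite andbT; move: pC qC pq; rewrite CE !inE.
move=> /orP[]/eqP -> /orP[]/eqP ->; rewrite ?eqxx // => _.
by rewrite adjC.
Qed.

Lemma nn_edge_interaction (X : set (config d 'Z_r)) : nn_interaction X edge_interaction.
Proof.
move=> a _ far; rewrite /edge_interaction /edge_sum; case: eqP => // a2.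
rewrite big_seq big1 // => n na; rewrite big_seq_cond big1 // => m /andP[ma nm].
by case: far; exact: adj_pair_diam na ma nm.
Qed.

Lemma shift_invariant_edge_interaction (X : set (config d 'Z_r)) :
  shift_invariant_interaction X edge_interaction.
Proof.
move=> a b _ _ [k ab].
have domE : domf a = translate (domf b) k.
  apply/fsetP => m; rewrite mem_translate -!fndSome.
  by rewrite ab subrK.
have inj : injective (fun m : site d => m + k) by move=> p q /addIr.
have -> : edge_interaction a = edge_sum (translate (domf b) k) (fun n => a.[? n]%fmap).
  by rewrite -domE.
rewrite /edge_interaction /edge_sum card_imfset //; case: eqP => // _.
rewrite big_imfset /=; last by move=> p q _ _; exact: inj.
apply: eq_bigr => n _; rewrite big_mkcond [RHS]big_mkcond big_imfset /=.
  by apply: eq_bigr => m _; rewrite adjDr !ab.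
by move=> p q _ _; exact: inj.
Qed.

(** An edge inside [W] is the domain of exactly one subpattern. *)
Lemma sum_edge_interaction x W :
  \sum_(C <- fpowerset W) edge_interaction (restr x C) = pair_energy v W x.
Proof.
pose e n m := if x m == x n + 1 then v (x n) else 0.
have phiE C : C \in fpowerset W -> edge_interaction (restr x C) =
    \sum_(n <- W) \sum_(m <- W | adj n m)
      if C == [fset n; m]%fset then e n m else 0.
  rewrite fpowersetE => CW.
  have C2 n m : adj n m -> (C == [fset n; m]%fset) = [&& #|` C| == 2%N, n \in C & m \in C].
    move=> nm; apply/eqP/and3P => [->|[/eqP c2 nC mC]].
      by rewrite cardfs2 (adj_neq nm) !inE !eqxx orbT.
    apply/eqP; rewrite eq_sym eqEfcard fsubUset !fsub1set nC mC /=.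
    by rewrite cardfs2 (adj_neq nm) c2.
  rewrite -(big_fset_incl _ CW) => [|n _ nC]; last first.
    by rewrite big1 // => m nm; rewrite C2 // (negPf nC) andbF.
  rewrite /edge_interaction -[domf _]/C /edge_sum; case: (boolP (#|` C| == 2%N)) => c2; last first.
    rewrite big1 // => n _; rewrite big1 // => m nm.
    by rewrite C2 // (negPf c2).
  rewrite big_seq [RHS]big_seq; apply: eq_bigr => n nC.
  rewrite [RHS]big_mkcond -[RHS](big_fset_incl _ CW) /=; last first.
    by move=> m _ mC; case: ifP => // nm; rewrite C2 // (negPf mC) !andbF.
  rewrite big_mkcond big_seq [RHS]big_seq; apply: eq_bigr => m mC.
  case: ifP => // nm; rewrite C2 // c2 nC mC /=.
  by rewrite !in_fnd /bond !ffunE.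
rewrite big_seq (eq_bigr _ phiE) -big_seq exchange_big /=.
rewrite /pair_energy big_seq [RHS]big_seq; apply: eq_bigr => n nW.
rewrite exchange_big /= big_seq_cond [RHS]big_mkcondr [RHS]big_seq_cond.
apply: eq_bigr => m /andP[mW nm].
rewrite (bigD1_seq [fset n; m]%fset) ?fset_uniq //=; last first.
  by rewrite fpowersetE fsubUset !fsub1set nW mW.
by rewrite eqxx big1 ?addr0 // => C /negPf ->.
Qed.

Lemma pair_energy_ext W x y : agree W y x -> pair_energy v W x = pair_energy v W y.
Proof.
move=> xy; rewrite /pair_energy big_seq [RHS]big_seq; apply: eq_bigr => n nW.
rewrite big_seq_cond [RHS]big_seq_cond (xy n nW).
by apply: eq_bigl => m; case: (boolP (m \in W)) => //= /xy ->.
Qed.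

End Interaction.

Section Gibbs.
Variables (R : realType) (d r : nat) (mu : probability (borel_config d 'Z_r) R).
Hypotheses (d1 : (1 < d)%N) (two_neq0 : (1 + 1 : 'Z_r) != 0).
Hypotheses (mu_shift : shift_invariant mu) (mrf : markov_random_field mu).
Hypothesis mu_adapted : adapted mu (X_ d r).
Variable v : 'Z_r -> R.
Hypothesis rateE : forall k, flippable mu k ->
  flip_rate mu k = (degree d)%:R * (v k - v (k - 1)).
Implicit Types (x y z : config d 'Z_r) (W F B : {fset site d}).

(** Patch [y] into [x] on [F]: the result is homoclinic to [x] and in the
    support, so the cocycle formula applies on a window large enough for the
    lifts, and both sides localize to [F] and its boundary. *)
Lemma supp_energy_difference F x y : supp mu x -> supp mu y ->
  (forall n, n \in boundary F -> x n = y n) ->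
  ln (weight mu (F `|` boundary F)%fset y) - ln (weight mu (F `|` boundary F)%fset x) =
  pair_energy v (F `|` boundary F)%fset y - pair_energy v (F `|` boundary F)%fset x.
Proof.
move=> sx sy xy; set V := (F `|` boundary F)%fset.
set z : config d 'Z_r := fun n => if n \in F then y n else x n.
have sz : supp mu z by exact: supp_patch.
have xz n : n \notin F -> x n = z n by rewrite /z => /negPf ->.
have zy : agree V y z.
  by move=> n; rewrite /z inE; case: ifP => //= _; exact: xy.
rewrite -(weight_ext mu zy) -(pair_energy_ext v zy).
have [h hh hx] : X_ d r x by apply: (proj1 mu_adapted).
have [g hg gz] : X_ d r z by apply: (proj1 mu_adapted).
have [|B Bco [g' [hg' g'g hB]]] := @homoclinic_lift d r d1 two_neq0 h g F hh hg.
  by move=> m mF; rewrite hx gz xz.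
pose W := (B `|` boundary B `|` V)%fset.
have BW : (B `|` boundary B `<=` W)%fset by exact: fsubsetUl.
have VW : (V `<=` W)%fset by exact: fsubsetUr.
have rate0 k : flippable mu k ->
    flip_rate mu k = 2 * 0 + (degree d)%:R * (v k - v (k - 1)).
  by move=> /rateE ->; rewrite mulr0 add0r.
rewrite -hx in sx.
have [_] := cocycle_formula d1 two_neq0 mu_shift mrf mu_adapted rate0 hh hg' Bco hB BW sx.
rewrite g'g gz hx mul0r add0r (pair_energy_patch v VW xz) => E.
rewrite hx in sx; move/suppE: (sx) => px; move/suppE: (sz) => pz.
have := congr1 (@ln R) (weight_ratio mrf VW px xz).
rewrite lnM ?posrE; [|exact: pz|exact: px].
rewrite lnM ?posrE; [|exact: px|exact: pz].
rewrite -/V; move: E; lra.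
Qed.

Lemma gibbs_edge_interaction : gibbs_state (edge_interaction v) mu.
Proof.
split=> //.
pose has F (b : pattern d 'Z_r) := [set x | supp mu x /\ restr x (boundary F) = b].
pose V F := (F `|` boundary F)%fset.
pose p F x := weight mu (V F) x / weight mu (boundary F) x.
(* The normalization at boundary pattern b is read off from an arbitrary
   configuration of the support that has this pattern; supp_energy_difference
   shows that the choice does not matter. *)
exists (fun F b => let x := get (has F b) in expR (pair_energy v (V F) x) / p F x).
move=> x F B sx FB dFB /=.
have [sy ry] : has F (restr x (boundary F)) (get (has F (restr x (boundary F)))).
  by apply: getPex; exists x.
move: (get _) sy ry => y sy /restrE yx.
rewrite cond_prob_restr markov_weight //; last by move/suppE: sx.
rewrite -expR_sum sum_edge_interaction.
have := supp_energy_difference sx sy (fun n nb => esym (yx n nb)).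
move/suppE: sx => px; move/suppE: sy => py.
rewrite /p (weight_ext mu yx) -/(V F) => E.
have pE z : (forall W, 0 < weight mu W z) -> weight mu (V F) z = expR (ln (weight mu (V F) z)).
  by move=> pz; rewrite lnK // posrE; exact: pz.
have -> : weight mu (V F) x = weight mu (V F) y * expR (pair_energy v (V F) x - pair_energy v (V F) y).
  rewrite (pE x px) (pE y py) -expRD; congr expR; move: E; lra.
have wy : weight mu (V F) y != 0 by rewrite lt0r_neq0.
have wb : weight mu (boundary F) x != 0 by rewrite lt0r_neq0.
have ey : expR (pair_energy v (V F) y) != 0 by rewrite lt0r_neq0 // expR_gt0.
rewrite expRD expRN; field.
by rewrite wb wy ey.
Qed.

End Gibbs.

Theorem theorem6p1 (R : realType) (d r : nat) (hd : (2 <= d)%N)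
    (hr0 : (0 < r)%N) (hr : r \notin [:: 1; 2; 4]%N)
    (mu : probability (borel_config d 'Z_r) R)
    (mu_shift : shift_invariant mu) (mu_mrf : markov_random_field mu) :
  (adapted mu (X_ d r) ->
    exists phi : pattern d 'Z_r -> R,
      [/\ nn_interaction (X_ d r) phi,
          shift_invariant_interaction (X_ d r) phi &
          gibbs_state phi mu]) /\
  (supp mu = X_ d r ->
    exists phi : pattern d 'Z_r -> R,
      [/\ nn_interaction (X_ d r) phi,
          shift_invariant_interaction (X_ d r) phi &
          gibbs_state phi mu]).
Proof.
have two_neq0 : (1 + 1 : 'Z_r) != 0.
  by case: r hr0 hr {mu mu_shift mu_mrf} => [|[|[|n]]].
have main : adapted mu (X_ d r) ->
    exists phi : pattern d 'Z_r -> R,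
      [/\ nn_interaction (X_ d r) phi,
          shift_invariant_interaction (X_ d r) phi &
          gibbs_state phi mu].
  move=> ad.
  have deg0 : (degree d)%:R != 0 :> R.
    by rewrite pnatr_eq0 -lt0n degree_gt0 // ltnW.
  have [v [gamma [rate flips]]] := cyclic_decomposition (flip_rate mu) (flippable mu) deg0.
  have gamma0 : gamma = 0.
    apply/eqP/negPn/negP => gn; have all := flips gn.
    have [g|g] : 0 < gamma * 1%:~R \/ 0 < gamma * (-1)%:~R.
      rewrite rmorphN1 mulr1 mulrN1 oppr_gt0; apply/orP.
      by rewrite orbC -neq_lt.
    - exact: (no_drift hd two_neq0 mu_shift mu_mrf ad rate (s := 1) (erefl _) g all).
    - exact: (no_drift hd two_neq0 mu_shift mu_mrf ad rate (s := -1) (erefl _) g all).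
  exists (edge_interaction v); split.
  - exact: nn_edge_interaction.
  - exact: shift_invariant_edge_interaction.
  - apply: gibbs_edge_interaction => // k /rate ->.
    by rewrite gamma0 mulr0 add0r.
split=> // E; apply: main; split; first by rewrite E.
by move=> x y _ []; rewrite E.
Qed.
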